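(* Let $d>1$ be an integer, let $f:A\to A$ be a covering map of degree $d$ of the open annulus $A=(0,1)\times S^1$, and let $h$ be a semiconjugacy between $f$ and $m_d$. Then there exists a trivial connector $C$, invariant under $f$ (that is, $f(C)=C$), contained in $h^{-1}(1)$.
   Context: $m_d:S^1\to S^1$, $m_d(z)=z^d$. A semiconjugacy between $f$ and $m_d$ is a continuous map $h:A\to S^1$ with $hf=m_dh$ such that $h_*:H_1(A,\mathbb{Z})\to H_1(S^1,\mathbb{Z})$ is an isomorphism. The degree of $f$ is the integer $d$ such that $f_*$ is multiplication by $d$ on $H_1(A,\mathbb{Z})\cong\mathbb{Z}$. An open set $U\subset A$ is essential if the map $H_1(U,\mathbb{Z})\to H_1(A,\mathbb{Z})=\mathbb{Z}$ induced by inclusion is onto; a subset $X\subset A$ is essential if every open neighbourhood of $X$ in $A$ is essential. A connector is a connected closed subset $C$ of $A$ having accumulation points in both components of the boundary of $A$, i.e. for every $r>0$ there are $(x,y),(x',y')\in C$ with $x<r$ and $x'>1-r$. A connector is trivial if it is not essential. *)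

(* Defs.v *)
From HB Require Import structures.
From mathcomp Require Import freeg.
From mathcomp Require Import all_boot all_order all_algebra.
From mathcomp Require Import generic_quotient ring_quotient.
From mathcomp Require Import boolp classical_sets functions set_interval.
From mathcomp Require Import reals topology normedtype.
From mathcomp Require Import complex.

Set Implicit Arguments.
Unset Strict Implicit.
Unset Printing Implicit Defensive.

Import Order.TTheory GRing.Theory Num.Theory.
Import numFieldTopology.Exports numFieldNormedType.Exports.

Local Open Scope classical_set_scope.
Local Open Scope ring_scope.
Local Open Scope quotient_scope.

Section SingularHomology.
Variable R : realType.

(* Barycentric coordinates: the simplex spanned by the canonical basis. *)
Definition std_simplex (n : nat) : set 'rV[R]_n.+1 :=
  [set t | (forall i, 0 <= t ord0 i) /\ \sum_i t ord0 i = 1].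

Arguments std_simplex n : clear implicits.

(* Inserts a zero as the i-th coordinate. *)
Definition face_row (n : nat) (i : 'I_n.+2) (t : 'rV[R]_n.+1) : 'rV[R]_n.+2 :=
  \row_j oapp (t ord0) 0 (unlift i j).

Lemma face_row_simplex n (i : 'I_n.+2) (t : std_simplex n) :
  face_row i (\val t) \in std_simplex n.+1.
Proof.
have [t0 t1] := set_mem (valP t); apply/mem_set; split=> [j|].
  by rewrite mxE; case: unlift => /=.
rewrite (bigD1_ord i) //= mxE unlift_none /= add0r -[RHS]t1.
by apply: eq_bigr => j _; rewrite mxE liftK.
Qed.

Definition face_fun n (i : 'I_n.+2) (t : std_simplex n) : std_simplex n.+1 :=
  Sub (face_row i (\val t)) (face_row_simplex i t).

Lemma face_fun_continuous n (i : 'I_n.+2) : continuous (@face_fun n i).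
Proof.
have face_row_continuous : continuous (@face_row n i).
  move=> t A [P tP PA]; exists (fun a k => P a (lift i k)) => [a k|s sP].
    by have := tP a (lift i k); rewrite mxE liftK (ord1 a).
  apply: PA => a j; rewrite mxE; have := tP a j; rewrite mxE.
  case: unliftP => [k ->|_] /=; last exact: nbhs_singleton.
  by move=> _; have := sP a k; rewrite (ord1 a).
move=> t; apply/continuous_comp_initial => {}t.
apply: (@continuous_comp _ _ _ set_val (face_row i)).
  exact: initial_continuous.
exact: face_row_continuous.
Qed.

HB.instance Definition _ n (i : 'I_n.+2) :=
  @isContinuous.Build _ _ (@face_fun n i) (@face_fun_continuous n i).

Definition face n (i : 'I_n.+2)
  : continuousType (std_simplex n) (std_simplex n.+1) := @face_fun n i.

Definition singular_simplex (n : nat) (X : topologicalType) :=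
  continuousType (std_simplex n) X.

HB.instance Definition _ n X := Choice.on (singular_simplex n X).

Definition chain (n : nat) (X : topologicalType) :=
  {freeg (singular_simplex n X) / int}.

HB.instance Definition _ n X := GRing.Lmodule.on (chain n X).

Definition simplex_face n (X : topologicalType) (i : 'I_n.+2)
  (s : singular_simplex n.+1 X) : singular_simplex n X := s \o face i.

Definition boundary n (X : topologicalType) : chain n.+1 X -> chain n X :=
  fglift (fun s => \sum_(i < n.+2) (-1) ^+ i *: << simplex_face i s >>).

Lemma boundary_is_zmod_morphism n (X : topologicalType) : zmod_morphism (@boundary n X).
Proof. exact: lift_is_additive. Qed.

HB.instance Definition _ n X :=
  GRing.isZmodMorphism.Build _ _ (@boundary n X) (@boundary_is_zmod_morphism n X).

Definition push_simplex n (X Y : topologicalType) (f : continuousType X Y)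
  (s : singular_simplex n X) : singular_simplex n Y := f \o s.

Definition push n (X Y : topologicalType) (f : continuousType X Y) :
  chain n X -> chain n Y :=
  fglift (fun s => << push_simplex f s >>).

Lemma push_is_zmod_morphism n (X Y : topologicalType) (f : continuousType X Y) :
  zmod_morphism (@push n X Y f).
Proof. exact: lift_is_additive. Qed.

HB.instance Definition _ n (X Y : topologicalType) (f : continuousType X Y) :=
  GRing.isZmodMorphism.Build _ _ (@push n X Y f) (@push_is_zmod_morphism n X Y f).

Lemma int_additiveZ (M N : lmodType int) (g : {additive M -> N}) (k : int) x :
  g (k *: x) = k *: g x.
Proof. by rewrite -[k]intz !scaler_int raddfMz. Qed.

Lemma boundary_push n (X Y : topologicalType) (f : continuousType X Y) (c : chain n.+1 X) :
  boundary (push f c) = push f (boundary c).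
Proof.
rewrite -[c]freeg_sumE !raddf_sum; apply: eq_bigr => s _.
have boundaryU m Z k (t : singular_simplex m.+1 Z) :
    boundary << k *g t >> =
    k *: \sum_(i < m.+2) (-1) ^+ i *: << simplex_face i t >>.
  exact: liftU.
have pushU m k (t : singular_simplex m X) :
    push f << k *g t >> = k *: << push_simplex f t >>.
  exact: liftU.
have boundaryZ k (x : chain n.+1 Y) : boundary (k *: x) = k *: boundary x.
  exact: (int_additiveZ (@boundary n Y)).
have pushZ k (x : chain n X) : push f (k *: x) = k *: push f x.
  exact: (int_additiveZ (@push n X Y f)).
rewrite /= pushU boundaryZ !boundaryU scale1r pushZ; congr (_ *: _).
rewrite raddf_sum; apply: eq_bigr => i _ /=; rewrite pushZ pushU scale1r.
congr (_ *: << _ >>); exact/continuousEP.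
Qed.

Definition is_cycle (X : topologicalType) (c : chain 1 X) : bool := boundary c == 0.

Lemma is_cycle_zmod_closed (X : topologicalType) : zmod_closed (@is_cycle X).
Proof.
split=> [|a b]; rewrite !unfold_in /is_cycle; first by rewrite raddf0.
by move=> /eqP a0 /eqP b0; rewrite raddfB /= a0 b0 subr0.
Qed.

HB.instance Definition _ X :=
  GRing.isZmodClosed.Build (chain 1 X) (@is_cycle X) (@is_cycle_zmod_closed X).

Record cycle (X : topologicalType) := Cycle {
  cycle_chain :> chain 1 X;
  _ : cycle_chain \in @is_cycle X
}.

HB.instance Definition _ X := [isSub for @cycle_chain X].
HB.instance Definition _ X := [Choice of cycle X by <:].
HB.instance Definition _ X := [SubChoice_isSubZmodule of cycle X by <:].

Definition is_boundary (X : topologicalType) (z : cycle X) : bool :=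
  `[< exists b : chain 2 X, boundary b = cycle_chain z >].

Lemma is_boundary_zmod_closed (X : topologicalType) : zmod_closed (@is_boundary X).
Proof.
split=> [|a b]; rewrite !unfold_in.
  by apply/asboolP; exists 0; rewrite raddf0.
move=> /asboolP[x xa] /asboolP[y yb]; apply/asboolP; exists (x - y).
by rewrite raddfB /= xa yb.
Qed.

HB.instance Definition _ X :=
  GRing.isZmodClosed.Build (cycle X) (@is_boundary X) (@is_boundary_zmod_closed X).

Definition H1 (X : topologicalType) :=
  Quotient.quot (GRing.ZmodClosed.clone (cycle X) (@is_boundary X) _).

HB.instance Definition _ X := GRing.Zmodule.on (H1 X).
HB.instance Definition _ X := ZmodQuotient.on (H1 X).

Section Functoriality.
Variables (X Y : topologicalType) (f : continuousType X Y).

Lemma push_is_cycle (z : cycle X) : push f (cycle_chain z) \in @is_cycle Y.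
Proof.
have /eqP c0 : boundary (cycle_chain z) == 0 by exact: (valP z).
apply/eqP.
by rewrite boundary_push c0 raddf0.
Qed.

Definition push_cycle (z : cycle X) : cycle Y := Cycle (push_is_cycle z).

(* Computed on a representative; H1_map_pi shows that the class of the image
   does not depend on the one chosen. *)
Definition H1_map (u : H1 X) : H1 Y := \pi_(H1 Y) (push_cycle (repr u)).

Lemma push_cycleB : zmod_morphism push_cycle.
Proof. by move=> a b; apply: val_inj; rewrite /= !raddfB. Qed.

Lemma H1_map_pi (z : cycle X) :
  H1_map (\pi_(H1 X) z) = \pi_(H1 Y) (push_cycle z).
Proof.
rewrite /H1_map; apply/eqP; rewrite -Quotient.idealrBE -push_cycleB.
have : repr (\pi_(H1 X) z) - z \in @is_boundary X.
  by rewrite Quotient.idealrBE reprK.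
rewrite !unfold_in => /asboolP[b bz]; apply/asboolP; exists (push f b).
by rewrite boundary_push bz.
Qed.

Lemma H1_map_is_zmod_morphism : zmod_morphism H1_map.
Proof.
move=> u v; rewrite -[u]reprK -[v]reprK -raddfB !H1_map_pi push_cycleB.
exact: raddfB.
Qed.

HB.instance Definition _ :=
  GRing.isZmodMorphism.Build _ _ H1_map H1_map_is_zmod_morphism.

End Functoriality.

End SingularHomology.

Arguments std_simplex R n : clear implicits.
Arguments H1_map R {X Y} f u.

Lemma set_val_continuous (X : topologicalType) (U : set X) :
  continuous (set_val : U -> X).
Proof. exact: initial_continuous. Qed.

Definition incl (X : topologicalType) (U : set X) : continuousType U X :=
  mkcts (@set_val_continuous X U).

Section Covering.
Variables X Y : topologicalType.

Definition homeo_on (f : X -> Y) (W : set X) (U : set Y) :=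
  [/\ set_bij W U f, {within W, continuous f} &
      exists2 g : Y -> X, {within U, continuous g} & {in W, cancel f g}].

(* F is the family of sheets above U. *)
Definition evenly_covered (f : X -> Y) (U : set Y) :=
  exists F : set (set X),
    [/\ F `<=` open, trivIset F id, \bigcup_(W in F) W = f @^-1` U &
        forall W, F W -> homeo_on f W U].

Definition covering_map (f : X -> Y) :=
  [/\ continuous f, set_surj [set: X] [set: Y] f &
      forall y, exists U, [/\ open U, U y & evenly_covered f U]].

End Covering.

Section Annulus.
Variable R : realType.

(* R[i]^o is C with the topology of its modulus. *)
Definition circle : set R[i]^o := [set z | `|z| = 1].

Definition annulus := (set_type (`]0, 1[ : set R) * circle)%type.

HB.instance Definition _ := Topological.on annulus.

Lemma circle_powP (d : int) (z : circle) :
  (\val z : R[i]^o) ^ d \in circle.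
Proof.
have norm1X (w : R[i]) : `|w| = 1 -> `|w ^ d| = 1.
  by case: d => n w1; rewrite ?NegzE -?exprnN -?exprnP ?normfV normrX w1 expr1n ?invr1.
by apply/mem_set; apply: norm1X; exact: (set_mem (valP z)).
Qed.

Definition circle_pow (d : int) (z : circle) : circle :=
  Sub ((\val z : R[i]^o) ^ d) (circle_powP d z).

Lemma circle1P : (1 : R[i]^o) \in circle.
Proof. by apply/mem_set; exact: (normr1 R[i]). Qed.

Definition circle1 : circle := Sub (1 : R[i]^o) circle1P.

(* As H1 R annulus is infinite cyclic, at most one d satisfies this. *)
Definition has_degree (f : continuousType annulus annulus) (d : int) :=
  forall u : H1 R annulus, H1_map R f u = u *~ d.

Definition semiconjugacy (f : annulus -> annulus) (d : int)
    (h : continuousType annulus circle) :=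
  h \o f = circle_pow d \o h /\ bijective (H1_map R h).

(* Only meant for U open. *)
Definition essential_open (U : set annulus) :=
  set_surj setT setT (H1_map R (incl U)).

Definition essential (S : set annulus) :=
  forall U, open U -> S `<=` U -> essential_open U.

(* p.1 is the radial coordinate, so the last two clauses say that C accumulates
   on both boundary components. *)
Definition connector (C : set annulus) :=
  [/\ closed C, connected C,
      forall r : R, 0 < r -> exists2 p, C p & \val p.1 < r &
      forall r : R, 0 < r -> exists2 p, C p & 1 - r < \val p.1].

Definition trivial_connector (C : set annulus) := connector C /\ ~ essential C.

End Annulus.

Arguments circle R : clear implicits.

(* Main.v *)
Require Import Defs.
(** Write the annulus as the quotient of the plane [R * R] by the vertical unit
    translation.  The map [h] lifts to [H : R * R -> R], and since [h] induces an
    isomorphism on [H1], a unit vertical translation changes [H] by a constant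
    [k = 1] or [k = -1].  As [f] is a covering it lifts to a homeomorphism [F] of
    the plane, which can be chosen so that [H o F = d H]; hence [F] preserves the
    sets [H > 0] and [H < 0] as well as their ends.  Let [V] be the component of
    [H > 0] containing its end, and [Z] the component of the complement of
    [closure V] containing the end of [H < 0].  Both are [F]-invariant, so the
    frontier of [Z] is an [F]-invariant closed subset of [H = 0] which meets every
    vertical line.  It is connected because the plane is unicoherent.  Its image
    in the annulus is the connector.  The neighbourhood [Re h > 0] of the connector
    is not essential, because there [h] lifts to the real line. *)
From HB Require Import structures.
From mathcomp Require Import freeg.
From mathcomp Require Import all_boot all_order all_algebra.
From mathcomp Require Import generic_quotient ring_quotient.
From mathcomp Require Import boolp classical_sets functions set_interval.
From mathcomp Require Import reals topology normedtype derive trigo.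
From mathcomp Require Import complex.
From mathcomp Require Import lra ring.

Set Implicit Arguments.
Unset Strict Implicit.
Unset Printing Implicit Defensive.

Import Order.TTheory GRing.Theory Num.Theory.
Import numFieldTopology.Exports numFieldNormedType.Exports.
Local Open Scope classical_set_scope.
Local Open Scope ring_scope.
Local Open Scope quotient_scope.

(** * Lifting through coverings *)

(** The frontier of [V] itself is not known to be connected, since the complement of [closure V] may
    have several components. Keeping one component [Z] adds the others to the side of [V]: the
    closure of [Z] and the complement of [Z] are then both connected, as unicoherence requires.
    Taking a component of [H > 0], and not the whole set, is what makes [closure V] connected. The
    ends are not constructed as objects. That a component contains an end means that the translates
    of each point by [n * k] lie in it for all large [n]; as [F] multiplies vertical shifts by [d],
    it respects this condition. Homology is converted into winding numbers: surjectivity on [H1]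
    yields a cycle around which [h] winds exactly once. Lifting is proved for arbitrary coverings
    because it serves both [expi] and [f]; lifting through [f] produces the inverse of [F]. *)

Section Lifting.
Variables (X E B : topologicalType) (p : E -> B).
Hypothesis cov : covering_map p.

(** Over one base point, equal values share a sheet and distinct values lie in disjoint sheets.
    Agreement and disagreement therefore both persist nearby, and the set where [u = v] is clopen in
    [S]. *)
Lemma lift_unique (S : set X) (u v : X -> E) (x0 : X) :
  connected S -> {within S, continuous u} -> {within S, continuous v} ->
  (forall x, S x -> p (u x) = p (v x)) -> S x0 -> u x0 = v x0 ->
  forall x, S x -> u x = v x.
Proof.
move=> cS /subspace_continuousP cu /subspace_continuousP cv puv Sx0 uv0.
pose A := [set x | S x -> u x = v x].
pose D := [set x | S x -> u x <> v x].
have [_ _ loc] := cov.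
have key x : S x -> (u x = v x -> nbhs x A) /\ (u x <> v x -> nbhs x D).
  move=> Sx; have [U [oU Ux [F [oF tF FU hF]]]] := loc (p (u x)).
  have [W1 FW1 W1x] : (\bigcup_(W in F) W) (u x) by rewrite FU.
  have [W2 FW2 W2x] : (\bigcup_(W in F) W) (v x) by rewrite FU /= -puv.
  have n1 : \forall y \near x, S y -> W1 (u y).
    by apply: (cu x Sx); apply: open_nbhs_nbhs; split=> //; exact: oF.
  have n2 : \forall y \near x, S y -> W2 (v y).
    by apply: (cv x Sx); apply: open_nbhs_nbhs; split=> //; exact: oF.
  have injW W : F W -> {in W &, injective p}.
    by move=> FW; have [[_ /= + _] _ _] := hF _ FW.
  split=> [uvx|uvx].
    have W12 : W1 = W2.
      by apply: tF => //; exists (u x); split=> //; rewrite uvx.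
    subst W2; near=> y => Sy; apply: (injW _ FW1); rewrite ?inE; last exact: puv.
      by move: Sy; near: y.
    by move: Sy; near: y.
  near=> y => Sy uvy; apply: uvx; apply: (injW _ FW1); rewrite ?inE //; last exact: puv.
  suff -> : W1 = W2 by [].
  apply: tF => //; exists (u y); split; first by move: Sy; near: y.
  by rewrite uvy; move: Sy; near: y.
pose C := S `&` [set x | u x = v x].
suff CS : C = S by move=> x; rewrite -{1}CS => -[].
apply: cS; first by exists x0.
  exists (A^°); first exact: open_interior.
  apply/seteqP; split=> x [Sx] => [uvx|/interior_subset Ax]; split=> //.
    exact: (key x Sx).1.
  exact: Ax.
exists (~` (D^°)); first by apply: open_closedC; exact: open_interior.
apply/seteqP; split=> x [Sx] => [uvx|nD]; split=> //.
  by move=> /interior_subset /(_ Sx).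
by apply: contrapT => uvx; apply: nD; exact: (key x Sx).2.
Unshelve. all: by end_near. Qed.

(** The base point and the value over it are arbitrary, so that a lift can be continued from any
    point shared with the next piece. *)
Definition liftable (g : X -> B) (S : set X) :=
  forall x0 e0, S x0 -> p e0 = g x0 ->
  exists u : X -> E, [/\ {within S, continuous u},
    forall x, S x -> p (u x) = g x & u x0 = e0].

(** Over an evenly covered set, [g] followed by the inverse of [p] on the sheet through [e0] is a
    lift, on every subset of [N] alike. *)
Lemma liftable_locally (g : X -> B) (x : X) : continuous g ->
  exists2 N, nbhs x N & forall S, S `<=` N -> liftable g S.
Proof.
move=> cg; have [_ _ loc] := cov.
have [U [oU Ux [F [oF tF FU hF]]]] := loc (g x).
exists (g @^-1` U); first by apply: cg; apply: open_nbhs_nbhs.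
move=> S SU x0 e0 Sx0 pe0.
have [W FW We0] : (\bigcup_(W in F) W) e0 by rewrite FU /= pe0; exact: SU.
have [bW _ [q cq qK]] := hF _ FW.
exists (q \o g); split=> /=.
- apply/subspace_continuousP => y Sy.
  have Ugy := SU _ Sy.
  have /subspace_continuousP/(_ _ Ugy) cqy := cq.
  move=> V /= /cqy; rewrite /within /= !near_simpl => nV.
  have := cg y _ nV; rewrite /= !near_simpl /=.
  by apply: filterS => z /= Vz Sz; apply: Vz; exact: SU.
- move=> y /SU; have [_ _ + ] := bW => /[apply] -[w Ww <-].
  by rewrite qK // inE.
- by rewrite /= -pe0 qK // inE.
Qed.

(** The second lift starts from the value of the first at a common point; uniqueness on the
    connected overlap makes them agree, and closedness makes the glued map continuous. *)
Lemma liftableU (g : X -> B) (S T : set X) : closed S -> closed T ->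
  connected (S `&` T) -> S `&` T !=set0 ->
  liftable g S -> liftable g T -> liftable g (S `|` T).
Proof.
move=> clS clT.
suff wl (S' T' : set X) : closed S' -> closed T' -> connected (S' `&` T') ->
    S' `&` T' !=set0 -> liftable g S' -> liftable g T' -> forall x0 e0, S' x0 ->
    p e0 = g x0 -> exists u : X -> E, [/\ {within S' `|` T', continuous u},
    forall x, (S' `|` T') x -> p (u x) = g x & u x0 = e0].
  move=> cST neST lS lT x0 e0 [Sx0|Tx0]; first exact: wl.
  by rewrite setUC; apply: wl => //; rewrite setIC.
move=> {}clS {}clT cST [x1 [Sx1 Tx1]] lS lT x0 e0 Sx0 pe0.
have [u [cu pu u0]] := lS _ _ Sx0 pe0.
have [v [cv pv v1]] := lT _ (u x1) Tx1 (pu _ Sx1).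
have uv x : (S' `&` T') x -> u x = v x.
  move: x; apply: (@lift_unique _ _ _ x1) => //.
  - by apply: continuous_subspaceW cu => ? [].
  - by apply: continuous_subspaceW cv => ? [].
  - by move=> x [Sx Tx]; rewrite pu // pv.
pose w x := if pselect (S' x) then u x else v x.
have wS x : S' x -> w x = u x by rewrite /w; case: pselect.
have wT x : T' x -> w x = v x.
  by rewrite /w; case: pselect => // Sx Tx; exact: uv.
exists w; split.
- apply: withinU_continuous => //.
    by apply: subspace_eq_continuous cu => x; rewrite inE => /wS.
  by apply: subspace_eq_continuous cv => x; rewrite inE => /wT.
- by move=> x [Sx|Tx]; [rewrite wS ?pu|rewrite wT ?pv].
- by rewrite wS.
Qed.

End Lifting.

(** * Connectedness and lifting in the plane *)

Section Plane.
Variable R : realType.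

(** The supremum of the right ends reachable from [a] cannot stop before [b]. This form of
    compactness, Cousin's lemma, replaces subdivisions and Lebesgue numbers. *)
Lemma cousin (P : R -> R -> Prop) :
  (forall a b c, a <= b -> b <= c -> P a b -> P b c -> P a c) ->
  (forall x, exists2 r, 0 < r &
     forall a b, x - r < a -> a <= b -> b < x + r -> P a b) ->
  forall a b, a <= b -> P a b.
Proof.
move=> Ptr Ploc a b ab.
pose S := [set x | a <= x <= b /\ P a x].
have Sa : S a.
  split; first by rewrite lexx.
  by have [r r0 Pr] := Ploc a; apply: Pr => //; lra.
have hS : has_sup S by split; [exists a|exists b => x [/andP[]]].
have [r r0 Pr] := Ploc (sup S).
have [x [/andP[ax xb] Pax] xS] := sup_adherent r0 hS.
have xs : x <= sup S by apply: ub_le_sup => //; [exact: hS.2|split=> //; apply/andP].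
have Py y : x <= y -> y < sup S + r -> P a y.
  by move=> xy ys; apply: Ptr Pax _ => //; exact: Pr.
have [bs|sb] := ltP b (sup S + r); first exact: Py.
have /(ub_le_sup hS.2) : S (sup S + r / 2).
  split; last by apply: Py; lra.
  by apply/andP; split; lra.
lra.
Qed.

Lemma pair_continuous (X Y Z : topologicalType) (f : X -> Y) (g : X -> Z) :
  continuous f -> continuous g -> continuous (fun x => (f x, g x)).
Proof. by move=> cf cg x; apply: cvg_pair; [exact: cf|exact: cg]. Qed.

Lemma lin_continuous (a b : R) : continuous (fun t : R => (1 - t) * a + t * b).
Proof.
move=> t; apply: cvgD; apply: cvgM; try exact: cvg_cst; last exact: cvg_id.
by apply: cvgB; [exact: cvg_cst|exact: cvg_id].
Qed.

Lemma nbhs_boxP (x : R * R) (A : set (R * R)) : nbhs x A <->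
  exists2 r, 0 < r & forall y, `|y.1 - x.1| < r -> `|y.2 - x.2| < r -> A y.
Proof.
split=> [[[N1 N2] [/= /nbhs_ballP[r1 /= r10 b1] /nbhs_ballP[r2 /= r20 b2]] sN]|[r r0 rA]].
  exists (Num.min r1 r2); first by rewrite lt_min r10.
  move=> y; rewrite !lt_min => /andP[y1 _] /andP[_ y2]; apply: sN; split=> /=.
    by apply: b1; rewrite /ball /= distrC.
  by apply: b2; rewrite /ball /= distrC.
exists (ball x.1 r, ball x.2 r); first by split; exact: nbhsx_ballx.
by move=> y [/=]; rewrite /ball /= [`|x.1 - _|]distrC [`|x.2 - _|]distrC => *; exact: rA.
Qed.

Definition seg (x y : R * R) (t : R) : R * R :=
  ((1 - t) * x.1 + t * y.1, (1 - t) * x.2 + t * y.2).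

Lemma seg_continuous x y : continuous (seg x y).
Proof. by apply: pair_continuous; exact: lin_continuous. Qed.

Lemma seg0 x y : seg x y 0 = x.
Proof. by case: x => a b; rewrite /seg subr0 !mul1r !mul0r !addr0. Qed.

Lemma seg1 x y : seg x y 1 = y.
Proof. by case: y => a b; rewrite /seg subrr !mul1r !mul0r !add0r. Qed.

Lemma segment_image_connected (X : topologicalType) (c : R -> X) (a b : R) :
  continuous c -> connected (c @` `[a, b]).
Proof.
move=> cc; apply: connected_continuous_connected; first exact: segment_connected.
exact: continuous_subspaceT.
Qed.

Lemma convex_connected (S : set (R * R)) :
  (forall x y t, S x -> S y -> 0 <= t <= 1 -> S (seg x y t)) -> connected S.
Proof.
move=> cvx; have [->|/set0P[x Sx]] := eqVneq S set0; first exact: connected0.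
have -> : S = \bigcup_(y in S) (seg x y @` `[0, 1]).
  apply/seteqP; split=> [y Sy|_ [y Sy [t /= t01 <-]]].
    exists y => //; exists 1; last exact: seg1.
    by rewrite /= in_itv /= ler01 lexx.
  by apply: cvx => //; rewrite in_itv in t01.
apply: bigcup_connected.
  exists x => y Sy; exists 0; last exact: seg0.
  by rewrite /= in_itv /= ler01 lexx.
by move=> y Sy; apply: segment_image_connected; exact: seg_continuous.
Qed.

Definition rect (a b c d : R) : set (R * R) :=
  [set x | (a <= x.1 <= b) /\ (c <= x.2 <= d)].

Lemma rect_convex a b c d x y t : rect a b c d x -> rect a b c d y ->
  0 <= t <= 1 -> rect a b c d (seg x y t).
Proof.
move=> [/andP[h1 h2] /andP[h3 h4]] [/andP[h5 h6] /andP[h7 h8]] /andP[t0 t1].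
by split; apply/andP; split; rewrite /seg /=; nra.
Qed.

Lemma rect_connected a b c d : connected (rect a b c d).
Proof. by apply: convex_connected => x y t; exact: rect_convex. Qed.

Lemma rect_closed a b c d : closed (rect a b c d).
Proof.
have -> : rect a b c d = (fst @^-1` `[a, b]) `&` (snd @^-1` `[c, d]).
  by apply/seteqP; split=> -[x y] [/=]; rewrite !in_itv.
apply: closedI; apply: closed_comp; try exact: itv_closed.
  by move=> x _; exact: cvg_fst.
by move=> x _; exact: cvg_snd.
Qed.

Section PlaneLift.
Variables (E B : topologicalType) (p : E -> B).
Hypothesis cov : covering_map p.
Variable g : R * R -> B.
Hypothesis cg : continuous g.

(** Cousin's lemma is used twice: rectangles are stacked along the second coordinate and, in thin
    strips around a height [y], juxtaposed along the first. A juxtaposition keeps the smaller of the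
    two strip widths. *)
Lemma liftable_rect a b c d : a <= b -> c <= d -> liftable p g (rect a b c d).
Proof.
move=> ab cd; move: c d cd; apply: cousin => [c d e cd de|y].
  have -> : rect a b c e = rect a b c d `|` rect a b d e.
    apply/seteqP; split=> -[x y] [] [/= /andP[h1 h2] /andP[h3 h4]].
    - have [h|h] := leP y d; [left|right]; split; apply/andP; split=> //=; lra.
    - by split; apply/andP; split=> //=; lra.
    - by split; apply/andP; split=> //=; lra.
  apply: liftableU => //; try exact: rect_closed.
    have -> : rect a b c d `&` rect a b d e = rect a b d d; last exact: rect_connected.
    apply/seteqP; split=> -[x y] [] => [[/= ? /andP[h1 h2]] [/= _ /andP[h3 h4]]|/= ? /andP[h1 h2]].
      by split=> //=; apply/andP; split; lra.
    by split; split=> //=; apply/andP; split; lra.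
  by exists (a, d); split; split=> /=; apply/andP; split=> //; lra.
suff [r r0 Pr] : exists2 r, 0 < r & forall c d, y - r < c -> c <= d -> d < y + r ->
    liftable p g (rect a b c d).
  by exists r.
move: a b ab; apply: cousin => [a b c ab bc [r1 r10 P1] [r2 r20 P2]|x].
  exists (Num.min r1 r2); first by rewrite lt_min r10.
  move=> d e yd de ey.
  have yd1 : y - r1 < d by apply: le_lt_trans yd; rewrite lerD2l lerN2 ge_min lexx.
  have yd2 : y - r2 < d by apply: le_lt_trans yd; rewrite lerD2l lerN2 ge_min lexx orbT.
  have ye1 : e < y + r1 by apply: lt_le_trans ey _; rewrite lerD2l ge_min lexx.
  have ye2 : e < y + r2 by apply: lt_le_trans ey _; rewrite lerD2l ge_min lexx orbT.
  have -> : rect a c d e = rect a b d e `|` rect b c d e.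
    apply/seteqP; split=> -[z t] [] [/= /andP[h1 h2] /andP[h3 h4]].
    - have [h|h] := leP z b; [left|right]; split; apply/andP; split=> //=; lra.
    - by split; apply/andP; split=> //=; lra.
    - by split; apply/andP; split=> //=; lra.
  have L1 := P1 d e yd1 de ye1; have L2 := P2 d e yd2 de ye2.
  apply: liftableU => //; try exact: rect_closed.
    have -> : rect a b d e `&` rect b c d e = rect b b d e; last exact: rect_connected.
    apply/seteqP; split=> -[z t] [] => [[/= /andP[h1 h2] ?] [/= /andP[h3 h4] _]|/= /andP[h1 h2] ?].
      by split=> //=; apply/andP; split; lra.
    by split; split=> //=; apply/andP; split; lra.
  by exists (b, d); split; split=> /=; apply/andP; split=> //; lra.
have [N /nbhs_boxP[r r0 rN] NL] := liftable_locally cov (x, y) cg.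
exists r => // a b xa ab bx; exists r => // c d yc cd dy.
apply: NL => -[z t] [/= /andP[h1 h2] /andP[h3 h4]].
by apply: rN; rewrite /= ltr_distlC; apply/andP; split; lra.
Qed.

(** Lifts on the growing squares [Q n] with the same value at [x0] agree by uniqueness; [N x] is
    large enough to make [Q (N x)] a neighbourhood of [x]. *)
Theorem plane_lift x0 e0 : p e0 = g x0 ->
  exists u, [/\ continuous u, forall x, p (u x) = g x & u x0 = e0].
Proof.
move=> pe0.
pose Q (n : nat) := rect (x0.1 - n%:R) (x0.1 + n%:R) (x0.2 - n%:R) (x0.2 + n%:R).
have Qx0 n : Q n x0.
  by have n0 := ler0n R n; split; apply/andP; split=> /=; lra.
have /choice[u hu] : forall n, exists u, [/\ {within Q n, continuous u},
    forall x, Q n x -> p (u x) = g x & u x0 = e0].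
  move=> n; have n0 := ler0n R n; apply: liftable_rect => //; try exact: Qx0; lra.
have Qle m n x : (m <= n)%N -> Q m x -> Q n x.
  rewrite -(ler_nat R) => mn [/andP[h1 h2] /andP[h3 h4]].
  by split; apply/andP; split; lra.
have agree m n x : (m <= n)%N -> Q m x -> u m x = u n x.
  move=> mn; have [c1 p1 e1] := hu m; have [c2 p2 e2] := hu n.
  apply: (@lift_unique _ _ _ _ cov (Q m) (u m) (u n) x0) => //.
  - exact: rect_connected.
  - by apply: continuous_subspaceW c2 => z; exact: Qle.
  - by move=> z Qz; rewrite p1 // p2 //; exact: Qle Qz.
  - by rewrite e1.
pose N x := (Num.truncn (`|x.1 - x0.1| + `|x.2 - x0.2|)).+1.
have NP x : `|x.1 - x0.1| + `|x.2 - x0.2| < (N x)%:R by exact: truncnS_gt.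
have QN x : nbhs x (Q (N x)).
  apply/nbhs_boxP; exists ((N x)%:R - (`|x.1 - x0.1| + `|x.2 - x0.2|)); first by rewrite subr_gt0.
  move=> y y1 y2; have := ler_distD x.1 y.1 x0.1; have := ler_distD x.2 y.2 x0.2.
  have := normr_ge0 (x.1 - x0.1); have := normr_ge0 (x.2 - x0.2) => h1 h2 h3 h4.
  have {}h4 : `|y.1 - x0.1| <= (N x)%:R by lra.
  have {}h3 : `|y.2 - x0.2| <= (N x)%:R by lra.
  by move: h3 h4; rewrite !ler_distl.
have QNx x : Q (N x) x by exact: nbhs_singleton.
exists (fun x => u (N x) x); split.
- move=> x; have [c1 p1 e1] := hu (N x).
  have cx : {for x, continuous (u (N x))}.
    have := c1 x; rewrite /continuous_at -nbhs_subspace_interior //; exact: QN.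
  apply: cvg_trans cx; apply: near_eq_cvg.
  near=> z; have Qz : Q (N x) z by near: z; exact: QN.
  by have [h|/ltnW h] := leqP (N x) (N z); [rewrite (agree _ _ _ h)|rewrite (agree _ _ _ h)].
- by move=> x; have [_ -> //] := hu (N x).
- by have [] := hu (N x0).
Unshelve. all: by end_near. Qed.


End PlaneLift.
End Plane.

(** * The exponential covering of the circle *)

Section Circle.
Variable R : realType.
Local Notation Re := complex.Re.
Local Notation Im := complex.Im.
Implicit Types (s t : R) (z : circle R).

Definition cre z : R := Re (\val z).
Definition cim z : R := Im (\val z).

Lemma Re_continuous : continuous (fun z : R[i]^o => Re z).
Proof.
move=> z; apply/(@cvgrPdist_lt R R _ (nbhs (z : R[i]^o)) _) => e e0.
have e0' : (0 : R[i]) < e%:C%C by rewrite ltcR.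
have nb : nbhs (z : R[i]^o) (ball (z : R[i]^o) e%:C%C) by exact: (@nbhsx_ballx _ R[i]^o).
apply: (@filterS _ (nbhs (z : R[i]^o)) _ _ _ _ nb) => w; rewrite /ball /=.
rewrite -[`|_ - _| < e]ltcR; apply: le_lt_trans.
by have := normc_ge_Re (z - w); rewrite raddfB.
Qed.

Lemma Im_continuous : continuous (fun z : R[i]^o => Im z).
Proof.
move=> z; apply/(@cvgrPdist_lt R R _ (nbhs (z : R[i]^o)) _) => e e0.
have e0' : (0 : R[i]) < e%:C%C by rewrite ltcR.
have nb : nbhs (z : R[i]^o) (ball (z : R[i]^o) e%:C%C) by exact: (@nbhsx_ballx _ R[i]^o).
apply: (@filterS _ (nbhs (z : R[i]^o)) _ _ _ _ nb) => w; rewrite /ball /=.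
rewrite -[`|_ - _| < e]ltcR; apply: le_lt_trans.
have := normc_ge_Re ('i%C * (z - w)); rewrite normrM.
have -> : `|('i)%C : R[i]| = 1 by rewrite normc_def /= expr0n expr1n add0r sqrtr1.
rewrite mul1r; apply: le_trans; rewrite lecR -normrN.
by case: z w {nb} => a b [c d] /=; rewrite !(mul0r, mul1r) sub0r.
Qed.

Lemma cre_continuous : continuous cre.
Proof.
by move=> z; apply: (continuous_comp (@set_val_continuous _ _ z)); exact: Re_continuous.
Qed.

Lemma cim_continuous : continuous cim.
Proof.
by move=> z; apply: (continuous_comp (@set_val_continuous _ _ z)); exact: Im_continuous.
Qed.

Lemma circleE z : cre z ^+ 2 + cim z ^+ 2 = 1.
Proof.
have := set_mem (valP z); rewrite /circle /= normc_def => -[].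
move=> /(congr1 (fun x => x ^+ 2)); rewrite expr1n sqr_sqrtr //.
by rewrite addr_ge0 // sqr_ge0.
Qed.

Lemma circle_inP (a b : R) : a ^+ 2 + b ^+ 2 = 1 ->
  ((a +i* b)%C : R[i]^o) \in circle R.
Proof.
by move=> ab; apply/mem_set; rewrite /circle /= normc_def /= ab sqrtr1.
Qed.

Definition mkcircle (a b : R) (ab : a ^+ 2 + b ^+ 2 = 1) : circle R :=
  Sub ((a +i* b)%C : R[i]^o) (circle_inP ab).

Lemma circle_eq z w : cre z = cre w -> cim z = cim w -> z = w.
Proof.
rewrite /cre /cim => h1 h2; apply: val_inj; move: h1 h2.
by case: (\val z) (\val w) => a b [c d] /= -> ->.
Qed.

Lemma continuous_to_circle (X : topologicalType) (f : X -> circle R) :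
  continuous (cre \o f) -> continuous (cim \o f) -> continuous f.
Proof.
move=> cr ci x; apply/continuous_comp_initial => {}x.
apply/(@cvgrPdist_lt R[i] R[i]^o) => e e0.
have [er ei] : 0 < Re e /\ Im e = 0 by move: e0; rewrite ltcE /= => /andP[/eqP-> ->].
near=> y.
have h1 : `|cre (f x) - cre (f y)| < Re e / 2.
  by near: y; apply: cvgr_dist_lt; [exact: cr|rewrite divr_gt0].
have h2 : `|cim (f x) - cim (f y)| < Re e / 2.
  by near: y; apply: cvgr_dist_lt; [exact: ci|rewrite divr_gt0].
rewrite normc_def ltcE /= ei eqxx /=.
move: h1 h2; rewrite /cre /cim /= !raddfB /= !ltr_norml => /andP[h1 h2] /andP[h3 h4].
rewrite -[ltRHS]gtr0_norm // -sqrtr_sqr ltr_sqrt ?exprn_gt0 //.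
by nra.
Unshelve. all: by end_near. Qed.

(** Angles are measured in turns: with this factor [expi] has period 1 and its fibres are the cosets
    of the integers. *)
Definition tau : R := pi *+ 2.

Lemma expi_subproof t : cos (tau * t) ^+ 2 + sin (tau * t) ^+ 2 = 1.
Proof. exact: cos2Dsin2. Qed.

Definition expi t : circle R := mkcircle (expi_subproof t).

Lemma cre_expi t : cre (expi t) = cos (tau * t). Proof. by []. Qed.
Lemma cim_expi t : cim (expi t) = sin (tau * t). Proof. by []. Qed.

Lemma expi_continuous : continuous expi.
Proof.
have ct : continuous (fun t => tau * t).
  by move=> t; apply: cvgM; [exact: cvg_cst|exact: cvg_id].
apply: continuous_to_circle => t.
  exact: (continuous_comp (ct t) (@continuous_cos R _)).
exact: (continuous_comp (ct t) (@continuous_sin R _)).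
Qed.

(* [crot t z] is the quotient of [z] by [expi t]. *)
Lemma crot_subproof t z :
  (cos (tau * t) * cre z + sin (tau * t) * cim z) ^+ 2 +
  (cos (tau * t) * cim z - sin (tau * t) * cre z) ^+ 2 = 1.
Proof.
have h1 := cos2Dsin2 (tau * t); have h2 := circleE z.
have -> : 1 = (cos (tau * t) ^+ 2 + sin (tau * t) ^+ 2) * (cre z ^+ 2 + cim z ^+ 2) by rewrite h1 h2 mulr1.
by ring.
Qed.

Definition crot t z : circle R := mkcircle (crot_subproof t z).

Lemma crot_continuous t : continuous (crot t).
Proof.
have cM (a b : R) : continuous (fun z => a * cre z + b * cim z).
  move=> z; exact: (cvgD (cvgM (cvg_cst a) (@cre_continuous z))
    (cvgM (cvg_cst b) (@cim_continuous z))).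
apply: continuous_to_circle => z; first exact: cM.
rewrite (_ : _ \o _ = (fun z => (- sin (tau * t)) * cre z + cos (tau * t) * cim z)).
  exact: cM.
by apply/funext => w; rewrite /= /cim /= mulNr addrC.
Qed.

Lemma crot_expi s t : crot s (expi t) = expi (t - s).
Proof.
apply: circle_eq; rewrite /cre /cim /= -!/(cre _) -!/(cim _) ?cre_expi ?cim_expi.
  by rewrite mulrBr cosB /cre /cim /=; ring.
by rewrite mulrBr sinB /cre /cim /=; ring.
Qed.

Lemma crotK t : cancel (crot t) (crot (- t)).
Proof.
move=> z; apply: circle_eq; rewrite /cre /cim /= /cre /cim /= mulrN cosN sinN -/(cre z) -/(cim z).
  by rewrite -[RHS]mul1r -(cos2Dsin2 (tau * t)); ring.
by rewrite -[RHS]mul1r -(cos2Dsin2 (tau * t)); ring.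
Qed.

Lemma tau_gt0 : 0 < tau. Proof. by rewrite pmulrn_rgt0 // pi_gt0. Qed.

Lemma expi_int t (n : R) : n \is a Num.int -> expi (t + n) = expi t.
Proof.
have pos (m : nat) u : expi (u + m%:R) = expi u.
  apply: circle_eq; rewrite /cre /cim /= mulrDr mulr_natr.
    exact: (periodicn (@cosD2pi R)).
  exact: (periodicn (@sinD2pi R)).
move=> /intrP[[m|m] ->]; first exact: pos.
by rewrite NegzE mulrNz -[in RHS](subrK m.+1%:R t) pos.
Qed.

(** The branch of the logarithm, in turns, on the right half circle; it is used where [0 < cre z],
    and there it inverts [expi]. *)
Definition log0 z : R := asin (cim z) / tau.

Lemma cim_itv z : -1 <= cim z <= 1.
Proof. by have := circleE z; have := sqr_ge0 (cre z) => ? ?; apply/andP; split; nra. Qed.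

Lemma log0K z : 0 < cre z -> expi (log0 z) = z.
Proof.
move=> z0; have zi := cim_itv z; have t0 := tau_gt0.
have e : tau * log0 z = asin (cim z) by rewrite /log0 mulrC divfK // gt_eqF.
apply: circle_eq; rewrite ?cre_expi ?cim_expi e; last by rewrite asinK // in_itv.
rewrite cos_asin // -(circleE z) addrK sqrtr_sqr gtr0_norm //.
Qed.

Lemma expiK t : `|t| < 1 / 4 -> log0 (expi t) = t.
Proof.
rewrite ltr_norml => /andP[h1 h2]; have t0 := tau_gt0; have p0 := pi_gt0 R.
rewrite /log0 cim_expi sinK ?in_itv /=; first by rewrite mulrC mulKf // gt_eqF.
by rewrite /tau; apply/andP; split; nra.
Qed.

Lemma cim_lt1 z : 0 < cre z -> -1 < cim z < 1.
Proof.
move=> z0; have := circleE z; have := mulr_gt0 z0 z0 => h1 h2.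
rewrite -ltr_norml -(@ltr_pXn2r _ 2) ?nnegrE // expr1n real_normK ?num_real //.
by rewrite expr2 in h2; lra.
Qed.

Lemma log0_lt z : 0 < cre z -> `|log0 z| < 1 / 4.
Proof.
move=> z0; have t0 := tau_gt0; have p0 := pi_gt0 R.
have /andP[y1 y2] := cim_lt1 z0.
have h1 : - (pi / 2) < asin (cim z) by apply: asin_gtNpi2; rewrite y1 ltW.
have h2 : asin (cim z) < pi / 2 by apply: asin_ltpi2; rewrite y2 ltW.
rewrite ltr_norml /log0 ltr_pdivrMr // ltr_pdivlMr // /tau.
by apply/andP; split; lra.
Qed.

Lemma log0_continuous z : 0 < cre z -> {for z, continuous log0}.
Proof.
move=> z0; have y12 := cim_lt1 z0.
exact: (cvgM (continuous_comp (@cim_continuous z) (continuous_asin y12)) (cvg_cst _)).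
Qed.

Lemma cre_expi_gt0 t : 0 < cre (expi t) <->
  exists2 n : R, n \is a Num.int & `|t - n| < 1 / 4.
Proof.
have p0 := pi_gt0 R.
split=> [|[n ni]]; last first.
  rewrite ltr_norml => /andP[h1 h2]; rewrite -[t](subrK n) expi_int // cre_expi.
  by apply: cos_gt0_pihalf; rewrite /tau; apply/andP; split; nra.
(* The integer nearest to [t]. If [t - n] were at least 1/4 in absolute value, half a turn would
   bring the angle to where the cosine is nonnegative, so the original cosine would not be
   positive. *)
pose n : R := (Num.floor (t + 1 / 2))%:~R.
have ni : n \is a Num.int by exact: intr_int.
have n1 : n <= t + 1 / 2 by rewrite /n floor_le_tmp.
have n2 : t + 1 / 2 < n + 1 by have := floorD1_gt (t + 1 / 2); rewrite intrD.
rewrite -[t](subrK n) expi_int // cre_expi => c0; exists n => //; rewrite addrK.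
rewrite ltr_norml; apply/andP; split; rewrite ltNge; apply/negP => hn.
  suff : 0 <= cos (tau * (t - n) + pi) by rewrite cosDpi; lra.
  by apply: cos_ge0_pihalf; rewrite /tau; apply/andP; split; nra.
suff : 0 <= cos (- (tau * (t - n)) + pi) by rewrite cosDpi cosN; lra.
by apply: cos_ge0_pihalf; rewrite /tau; apply/andP; split; nra.
Qed.

Lemma expi_inj s t : expi s = expi t -> s - t \is a Num.int.
Proof.
move=> st; have e0 : expi (s - t) = expi 0 by rewrite -crot_expi st crot_expi subrr.
have : 0 < cre (expi (s - t)) by rewrite e0 cre_expi mulr0 cos0.
move=> /cre_expi_gt0[n ni /expiK].
rewrite expi_int ?rpredN // e0 expiK; first by move=> /esym/eqP; rewrite subr_eq0 => /eqP ->.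
by rewrite normr0; lra.
Qed.

Lemma expi_eq s t : expi s = expi t <-> s - t \is a Num.int.
Proof.
split=> [/expi_inj//|st]; rewrite -[s](subrK t) addrC expi_int //.
Qed.

(** The branch of the logarithm around [t], obtained by rotating [log0]. The last clause reads it on
    the sheet of index [n], the interval of radius 1/4 around [t + n]. *)
Lemma expi_section (t : R) : exists2 l : circle R -> R,
  forall z, 0 < cre (crot t z) ->
    [/\ expi (l z) = z, {for z, continuous l} & `|l z - t| < 1 / 4] &
  forall s n, n \is a Num.int -> `|s - t - n| < 1 / 4 -> l (expi s) = s - n.
Proof.
exists (fun z => t + log0 (crot t z)) => [z z0|s n ni h]; last first.
  rewrite crot_expi -[s - t](subrK n) expi_int // expiK //; ring.
split.
- by rewrite -[RHS](crotK t) -[in RHS](log0K z0) crot_expi opprK addrC.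
- exact: (cvgD (cvg_cst t) (continuous_comp (@crot_continuous t z) (log0_continuous z0))).
- by rewrite addrAC subrr add0r log0_lt.
Qed.

Lemma expi_surj z : exists t, expi t = z.
Proof.
have t0 : tau != 0 by rewrite gt_eqF // tau_gt0.
have cz : -1 <= cre z <= 1.
  by have := circleE z; have := sqr_ge0 (cim z) => ? ?; apply/andP; split; nra.
have s1 : sin (acos (cre z)) = `|cim z|.
  by rewrite sin_acos // -(circleE z) addrAC subrr add0r sqrtr_sqr.
have [c0|c0] := leP 0 (cim z); [exists (acos (cre z) / tau)|exists (- acos (cre z) / tau)];
  apply: circle_eq; rewrite ?cre_expi ?cim_expi mulrC divfK ?cosN ?sinN ?s1 ?acosK ?in_itv //.
  by rewrite ger0_norm.
by rewrite ltr0_norm // opprK.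
Qed.

(** Open half circles are evenly covered, with sheets the intervals of radius 1/4 around [t0 + n];
    distinct centres are at least 1 apart. *)
Lemma expi_covering : covering_map expi.
Proof.
split=> [|z _|z].
- exact: expi_continuous.
- by have [t <-] := expi_surj z; exists t.
have [t0 <-] := expi_surj z.
have [l lP lK] := expi_section t0.
exists [set w | 0 < cre (crot t0 w)]; split.
- have c : continuous (cre \o crot t0).
    by move=> w; apply: continuous_comp; [exact: crot_continuous|exact: cre_continuous].
  have /continuousP/(_ [set x | 0 < x] (@open_gt _ 0)) := c; apply: id.
- by rewrite /= crot_expi subrr cre_expi mulr0 cos0.
pose W (n : R) : set R := [set t | `|t - t0 - n| < 1 / 4].
exists [set V | exists2 n : R, n \is a Num.int & V = W n]; split.
- move=> _ [n _ ->]; rewrite (_ : W n = ball (t0 + n) (1 / 4)); first exact: ball_open.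
  have e t : `|t0 + n - t| = `|t - t0 - n| by rewrite distrC opprD addrA.
  by apply/seteqP; split=> t; rewrite /ball /W /= e.
- move=> _ _ [n ni ->] [m mi ->] [t [/= h1 h2]].
  suff -> : n = m by [].
  apply/eqP; rewrite -subr_eq0; apply: contraT => nm.
  have := norm_intr_ge1 (rpredB ni mi) nm; rewrite leNgt => /negP[]; rewrite ltr_norml.
  by move: h1 h2; rewrite /W /= !ltr_norml => /andP[? ?] /andP[? ?]; apply/andP; split; lra.
- apply/seteqP; split=> [t [_ [n ni ->] h]|t /=].
    by rewrite /= crot_expi; apply/cre_expi_gt0; exists n.
  rewrite crot_expi => /cre_expi_gt0[n ni h].
  by exists (W n) => //; exists n.
move=> _ [n ni ->].
have Kn t : W n t -> l (expi t) + n = t by move=> h; rewrite (lK t n) // subrK.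
split.
- split.
  + by move=> t h; rewrite /= crot_expi; apply/cre_expi_gt0; exists n.
  + by move=> s t; rewrite !inE => /Kn {2}<- /Kn {2}<- ->.
  + move=> w w0; have [el _ lt] := lP w w0; exists (l w + n); last by rewrite expi_int.
    by rewrite /W /= addrAC addrK.
- by apply: continuous_subspaceT; exact: expi_continuous.
- exists (fun w => l w + n); last by move=> t /set_mem; exact: Kn.
  apply: continuous_in_subspaceT => w /set_mem /lP[_ cl _].
  exact: (cvgD cl (cvg_cst n)).
Qed.

End Circle.

Arguments cre {R} z.
Arguments cim {R} z.
Arguments expi {R} t.
Arguments expi_continuous {R} x.
Arguments expi_covering {R}.

(** * Unicoherence of the plane *)

Section Unicoherence.
Variable R : realType.
Local Notation plane := (R * R)%type.

Lemma plane_connected : connected [set: plane].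
Proof. exact: convex_connected. Qed.

(* Eilenberg's argument: if [A `&` B] were the union of two separated pieces, a
   function [u] equal to 0 on one and 1 on the other would give a circle-valued
   map, [expi (u / 2)] on [A] and [expi (- u / 2)] on [B].  A real lift of it
   differs from [u / 2] on [A], and from [- u / 2] on [B], by a constant, which is
   inconsistent on the second piece. *)
Theorem plane_unicoherent (A B : set plane) : closed A -> closed B ->
  connected A -> connected B -> A `|` B = setT -> connected (A `&` B).
Proof.
move=> clA clB cA cB AB; apply: contrapT => /connectedPn[E [En0 EK [sE1 sE2]]].
have clK : closed (A `&` B) by exact: closedI.
have clE b : closed (E b).
  move=> x Ex; have : (A `&` B) x.
    by apply: clK; apply: closureS Ex; rewrite EK; case: b => ? ?; [right|left].
  rewrite EK => -[] {En0}; case: b Ex => // Ex Ex'; exfalso.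
    by have : set0 x by rewrite -sE2.
  by have : set0 x by rewrite -sE1.
have E0 : E false `&` E true = set0.
  by rewrite -subset0 => x [h1 h2]; rewrite -sE1; split=> //; exact: subset_closure.
have nplane := @pseudometric_normal R plane.
have /(@uniform_separatorP _ R)[u [cu _ u0 u1]] :=
  (@normal_separatorP R plane).1 nplane (E false) (E true) (clE _) (clE _) E0.
have {}u0 x : E false x -> u x = 0 by move=> Ex; apply: u0; exists x.
have {}u1 x : E true x -> u x = 1 by move=> Ex; apply: u1; exists x.
pose up x := u x / 2; pose un x := - u x / 2.
have cup : continuous up by move=> x; exact: (cvgM (cu x) (cvg_cst _)).
have cun : continuous un by move=> x; exact: (cvgM (cvgN (cu x)) (cvg_cst _)).
pose g x := if pselect (A x) then expi (up x) else expi (un x).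
have gA x : A x -> g x = expi (up x) by rewrite /g; case: pselect.
have gB x : B x -> g x = expi (un x).
  rewrite /g; case: pselect => // Ax Bx; apply/expi_eq.
  have : (A `&` B) x by [].
  rewrite EK /up /un => -[/u0->|/u1->].
    by rewrite oppr0 mul0r subrr.
  by rewrite mulN1r opprK (_ : _ + _ = 1) ?int_num1 //; lra.
have cg : continuous g.
  apply/continuous_subspace_setT; rewrite -AB; apply: withinU_continuous => //.
    have c1 : {within A, continuous (expi \o up)}.
      by apply: continuous_subspaceT => x; apply: continuous_comp; [exact: cup|exact: expi_continuous].
    by apply: subspace_eq_continuous c1 => x; rewrite inE => /gA.
  have c1 : {within B, continuous (expi \o un)}.
    by apply: continuous_subspaceT => x; apply: continuous_comp; [exact: cun|exact: expi_continuous].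
  by apply: subspace_eq_continuous c1 => x; rewrite inE => /gB.
have [p Ep] := En0 false; have [q Eq] := En0 true.
have [Ap Bp] : (A `&` B) p by rewrite EK; left.
have [Aq Bq] : (A `&` B) q by rewrite EK; right.
have [th [cth gth thp]] : exists th, [/\ continuous th, forall x, expi (th x) = g x & th p = 0].
  by apply: plane_lift => //; [exact: expi_covering|rewrite gA // /up u0 // mul0r].
have h1 : th q = up q.
  apply: (@lift_unique _ _ _ _ expi_covering A th up p) => //.
  - exact: continuous_subspaceT.
  - exact: continuous_subspaceT.
  - by move=> x Ax; rewrite gth gA.
  - by rewrite thp /up u0 // mul0r.
have h2 : th q = un q.
  apply: (@lift_unique _ _ _ _ expi_covering B th un p) => //.
  - exact: continuous_subspaceT.
  - exact: continuous_subspaceT.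
  - by move=> x Ax; rewrite gth gB.
  - by rewrite thp /un u0 // oppr0 mul0r.
move: h1; rewrite h2 /up /un u1 //; lra.
Qed.

Lemma component_open (O : set plane) x : open O -> open (connected_component O x).
Proof.
move=> oO; rewrite openE => y xy.
have Oy : O y by exact: connected_component_sub xy.
have /nbhs_boxP[r r0 rO] : nbhs y O by exact: open_nbhs_nbhs.
have r2 : 0 < r / 2 by rewrite divr_gt0.
rewrite /interior (same_connected_component xy); apply/nbhs_boxP; exists (r / 2) => // z z1 z2.
pose S := rect (y.1 - r / 2) (y.1 + r / 2) (y.2 - r / 2) (y.2 + r / 2).
apply: (@connected_component_max _ O S); last first.
- by split; rewrite -ler_distl ltW.
- exact: rect_connected.
- by move=> w [h1 h2]; apply: rO; rewrite ltr_distl; lra.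
by split; apply/andP; split; lra.
Qed.

(** * Frontiers of complementary components *)

Section Boundary.
Variable M : set plane.
Hypotheses (clM : closed M) (cM : connected M) (M0 : M !=set0).
Let comp := connected_component (~` M).

Let openMC : open (~` M). Proof. by rewrite openC. Qed.

(** The component of a frontier point outside [M] would be a neighbourhood of it, hence meet
    [comp q] and equal it. *)
Lemma component_bd_sub q : closure (comp q) `\` comp q `<=` M.
Proof.
move=> x [clx nx]; apply: contrapT => Mx; apply: nx.
have nb : nbhs x (comp x).
  apply: open_nbhs_nbhs; split; first exact: component_open.
  exact: connected_component_refl.
have [y [qy xy]] := clx _ nb.
exact: (connected_component_trans qy (connected_component_sym xy)).
Qed.

(* Otherwise the component would be clopen. *)
Lemma component_closure_meet q : ~ M q -> closure (comp q) `&` M !=set0.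
Proof.
move=> Mq; apply: contrapT => h.
have e : comp q = setT.
  apply: plane_connected.
  - by exists q; exact: connected_component_refl.
  - by exists (comp q); [exact: component_open|rewrite setTI].
  - exists (closure (comp q)); first exact: closed_closure.
    rewrite setTI; apply/seteqP; split; first exact: subset_closure.
    move=> x clx; apply: contrapT => nx; apply: h; exists x; split=> //.
    exact: (@component_bd_sub q).
have [m Mm] := M0; have : comp q m by rewrite e.
by move=> /connected_component_sub.
Qed.

(** The complement consists of [M] and the closures of the other components; each closure is
    connected and meets the connected set [M]. *)
Lemma component_compl_connected q : connected (~` comp q).
Proof.
pose S y := if pselect (M y) then M else M `|` closure (comp y).
have MS y : M `<=` S y by rewrite /S; case: pselect => My x Mx //; left.
have -> : ~` comp q = \bigcup_(y in ~` comp q) S y.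
  apply/seteqP; split=> x.
    move=> qx; exists x => //; rewrite /S; case: pselect => // Mx; right.
    by apply: subset_closure; exact: connected_component_refl.
  move=> [y qy]; rewrite /S; case: pselect => My; first by move=> Mx /connected_component_sub.
  move=> [Mx /connected_component_sub//|clx qx].
  have [z [yz qz]] : comp y `&` comp q !=set0.
    by apply: clx; apply: open_nbhs_nbhs; split=> //; exact: component_open.
  apply: qy; exact: (connected_component_trans qz (connected_component_sym yz)).
have [m Mm] := M0.
apply: bigcup_connected; first by exists m => y _; exact: MS.
move=> y _; rewrite /S; case: pselect => // My; apply: connectedU => //.
  by rewrite setIC; exact: component_closure_meet.
by apply: connected_closure; exact: component_connected.
Qed.

(** The frontier is the intersection of [closure (comp q)] and the complement of [comp q], two
    closed connected sets that cover the plane. *)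
Lemma component_bd_connected q : connected (closure (comp q) `\` comp q).
Proof.
apply: plane_unicoherent.
- exact: closed_closure.
- by apply: open_closedC; exact: component_open.
- by apply: connected_closure; exact: component_connected.
- exact: component_compl_connected.
apply/seteqP; split=> // x _; have [h|h] := pselect (comp q x); last by right.
by left; exact: subset_closure.
Qed.

Lemma component_bd_closed q : closed (closure (comp q) `\` comp q).
Proof.
apply: closedI; first exact: closed_closure.
by apply: open_closedC; exact: component_open.
Qed.

End Boundary.
End Unicoherence.

(** * Winding numbers of singular 1-chains *)

Section Simplices.
Variable R : realType.
Local Notation plane := (R * R)%type.
Local Notation simplex n := (std_simplex R n).

(** Simplices will inherit lifting from the plane as retracts: [g \o r] is lifted on the plane and
    the lift is restricted along [i]. *)
Lemma retract_lift (X E B : topologicalType) (p : E -> B) (i : X -> plane)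
    (r : plane -> X) (g : X -> B) x0 e0 :
  covering_map p -> continuous i -> continuous r -> cancel i r ->
  continuous g -> p e0 = g x0 ->
  exists u, [/\ continuous u, forall x, p (u x) = g x & u x0 = e0].
Proof.
move=> cp ci cr ir cg pe.
have cgr : continuous (g \o r) by move=> x; apply: continuous_comp; [exact: cr|exact: cg].
have [|u [cu gu u0]] := plane_lift cp cgr (x0 := i x0) (e0 := e0); first by rewrite /= ir.
exists (u \o i); split=> // [x|x]; last by rewrite /= gu /= ir.
by apply: continuous_comp; [exact: ci|exact: cu].
Qed.

Lemma retract_connected (X : topologicalType) (i : X -> plane) (r : plane -> X) :
  continuous r -> cancel i r -> connected [set: X].
Proof.
move=> cr ir; have -> : [set: X] = r @` setT.
  by apply/seteqP; split=> // x _; exists (i x).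
apply: connected_continuous_connected; first exact: plane_connected.
exact: continuous_subspaceT.
Qed.

Lemma pos_sum_gt0 n (c : 'I_n.+1 -> R) : \sum_j c j = 1 ->
  0 < \sum_j Num.max 0 (c j).
Proof.
move=> c1; apply: lt_le_trans ltr01 _; rewrite -c1.
by apply: ler_sum => j _; rewrite le_max lexx orbT.
Qed.

Lemma clip_subproof n (c : 'I_n.+1 -> R) : \sum_j c j = 1 ->
  (\row_j (Num.max 0 (c j) / \sum_k Num.max 0 (c k))) \in simplex n.
Proof.
move=> /pos_sum_gt0 c0; apply/mem_set; split=> [j|].
  by rewrite mxE divr_ge0 ?le_max ?lexx // ltW.
under eq_bigr do rewrite mxE.
by rewrite -mulr_suml divff // gt_eqF.
Qed.

Lemma sum_continuous_at (X : topologicalType) (I : finType) (F : I -> X -> R) (x : X) :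
  (forall i, {for x, continuous (F i)}) ->
  {for x, continuous (fun y => \sum_i F i y)}.
Proof.
move=> cF; elim: (index_enum I) => [|j s IH].
  rewrite (_ : (fun y => _) = cst 0); first exact: cvg_cst.
  by apply/funext => y; rewrite big_nil.
rewrite (_ : (fun y => _) = (fun y => F j y + \sum_(i <- s) F i y)).
  exact: (cvgD (cF j) IH).
by apply/funext => y; rewrite big_cons.
Qed.

(* The affine coordinates [c] are made nonnegative and renormalized; the sum of
   the positive parts is at least 1. *)
Lemma simplex_retract n (i : simplex n -> plane) (c : plane -> 'I_n.+1 -> R) :
  (forall j, continuous (c^~ j)) -> (forall p, \sum_j c p j = 1) ->
  continuous i -> (forall t j, c (i t) j = \val t ord0 j) ->
  exists2 r : plane -> simplex n, continuous r & cancel i r.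
Proof.
move=> cc c1 ci ct.
exists (fun p => Sub (\row_j (Num.max 0 (c p j) / \sum_k Num.max 0 (c p k))) (clip_subproof (c1 p))).
  move=> p; apply/continuous_comp_initial => {}p /=.
  move=> A [P pP PA].
  have cM j : {for p, continuous (fun p => Num.max 0 (c p j))}.
    exact: (continuous_max (cvg_cst 0) (cc j p)).
  have cS : {for p, continuous (fun p => \sum_k Num.max 0 (c p k))}.
    exact: sum_continuous_at.
  have cQ j : {for p, continuous (fun p => Num.max 0 (c p j) / \sum_k Num.max 0 (c p k))}.
    apply: (cvgM (cM j) (cvgV _ cS)).
    by rewrite gt_eqF // pos_sum_gt0.
  pose f j : set plane := [set q | P ord0 j (Num.max 0 (c q j) / \sum_k Num.max 0 (c q k))].
  have fp : \forall q \near p, forall j, f j q.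
    apply: (@filter_forall plane _ f (nbhs p) _) => j; apply: (cQ j).
    by have := pP ord0 j; rewrite mxE.
  apply: filterS fp => q Pq; apply: PA => a j; rewrite (ord1 a) /= mxE; exact: Pq.
move=> t; apply: val_inj => /=; apply/rowP => j; rewrite mxE.
have [t0 t1] := set_mem (valP t).
have e k : Num.max 0 (c (i t) k) = \val t ord0 k.
  by rewrite ct max_r.
under eq_bigr do rewrite e.
by rewrite t1 e divr1.
Qed.

Lemma simplex_coord_continuous n (j : 'I_n.+1) : continuous (fun t : simplex n => \val t ord0 j).
Proof.
move=> t.
exact: (continuous_comp (@set_val_continuous _ _ t) (@coord_continuous R _ _ ord0 j _)).
Qed.

Lemma simplex1_retract : exists (i : simplex 1 -> plane) (r : plane -> simplex 1),
  [/\ continuous i, continuous r & cancel i r].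
Proof.
pose i (t : simplex 1) : plane := (\val t ord0 ord_max, 0).
have ci : continuous i by apply: pair_continuous; [exact: simplex_coord_continuous|exact: cst_continuous].
pose c (p : plane) (j : 'I_2) := if j == ord_max then p.1 else 1 - p.1.
have c1 : continuous (fun p : plane => p.1) by move=> p; exact: cvg_fst.
have [||||r cr ir] := @simplex_retract 1 i c.
- move=> j; rewrite /c; case: (j == ord_max) => p; first exact: c1.
  exact: (cvgB (cvg_cst (1 : R)) (c1 p)).
- by move=> p; rewrite !big_ord_recl big_ord0 /c /= addr0 subrK.
- exact: ci.
- move=> t j; rewrite /c; case: eqP => [->//|jm] /=.
  have [_ t1] := set_mem (valP t); rewrite -t1 !big_ord_recr big_ord0 /= add0r addrK.
  by congr (\val t _ _); apply: val_inj; case: j jm => -[|[|//]] jl //= [];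
    apply: val_inj.
by exists i, r.
Qed.

Lemma simplex2_retract : exists (i : simplex 2 -> plane) (r : plane -> simplex 2),
  [/\ continuous i, continuous r & cancel i r].
Proof.
pose j1 : 'I_3 := lift ord0 ord0.
pose i (t : simplex 2) : plane := (\val t ord0 ord0, \val t ord0 j1).
have ci : continuous i by apply: pair_continuous; exact: simplex_coord_continuous.
pose c (p : plane) (j : 'I_3) :=
  if j == ord0 then p.1 else if j == j1 then p.2 else 1 - (p.1 + p.2).
have c1 : continuous (fun p : plane => p.1) by move=> p; exact: cvg_fst.
have c2 : continuous (fun p : plane => p.2) by move=> p; exact: cvg_snd.
have [||||r cr ir] := @simplex_retract 2 i c.
- move=> j; rewrite /c; case: (j == ord0) => p; first exact: c1.
  case: (j == j1); first exact: c2.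
  exact: (cvgB (cvg_cst (1 : R)) (cvgD (c1 p) (c2 p))).
- by move=> p; rewrite !big_ord_recl big_ord0 /c /=; ring.
- exact: ci.
- move=> t j; rewrite /c; case: eqP => [->//|jm] /=; case: eqP => [->//|jm'] /=.
  have [_ t1] := set_mem (valP t); rewrite -t1 !big_ord_recl big_ord0 addr0 /j1.
  transitivity (\val t ord0 (lift ord0 (lift ord0 ord0))); first by ring.
  congr (\val t _ _); apply: val_inj; case: j jm jm' => -[|[|[|//]]] jl //=.
    by case; apply: val_inj.
  by move=> _ []; apply: val_inj.
by exists i, r.
Qed.

End Simplices.

Section ChainMorphisms.
Variable R : realType.
Variables (n : nat) (X : topologicalType).
Local Notation chain := (chain R n X).

Lemma freegU_scale (k : int) (s : singular_simplex R n X) :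
  << k *g s >> = << s >> *~ k :> chain.
Proof. by rewrite freegU_mulz intz. Qed.

Lemma chain_additive_eq (M : zmodType) (g1 g2 : {additive chain -> M}) :
  (forall s, g1 << s >> = g2 << s >>) -> g1 =1 g2.
Proof.
move=> g12 c; rewrite -[c]freeg_sumE !raddf_sum; apply: eq_bigr => s _.
by rewrite freegU_scale !raddfMz g12.
Qed.

(* [fglift] needs a Z-module as codomain, hence [zmodule R] instead of [R]. *)
Definition simplexwise (phi : singular_simplex R n X -> R) : chain -> zmodule R :=
  fglift (phi : _ -> zmodule R).

Lemma simplexwise_is_zmod_morphism phi : zmod_morphism (simplexwise phi).
Proof. exact: lift_is_additive. Qed.

HB.instance Definition _ phi :=
  GRing.isZmodMorphism.Build _ _ (simplexwise phi) (simplexwise_is_zmod_morphism phi).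

Lemma simplexwiseU phi s : simplexwise phi << s >> = phi s.
Proof. by rewrite /simplexwise liftU scale1r. Qed.

Lemma simplexwise_int phi c : (forall s, phi s \is a Num.int) ->
  (simplexwise phi c : R) \is a Num.int.
Proof.
move=> phii; rewrite -[c]freeg_sumE raddf_sum.
apply: (big_ind (fun x : zmodule R => (x : R) \is a Num.int)) => [|x y|s _].
- exact: rpred0.
- exact: rpredD.
- by rewrite freegU_scale raddfMz /= simplexwiseU; exact: (@rpredMz R).
Qed.

End ChainMorphisms.

(** * The winding cocycle on the circle *)

Section Winding.
Variable R : realType.
Local Notation simplex n := (std_simplex R n).

Lemma vertex_subproof n (j : 'I_n.+1) :
  (\row_k (k == j)%:R : 'rV[R]_n.+1) \in std_simplex R n.
Proof.
apply/mem_set; split=> [k|]; first by rewrite mxE ler0n.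
by rewrite (bigD1 j) //= mxE eqxx big1 ?addr0 // => k /negbTE kj; rewrite mxE kj.
Qed.

Definition vertex n (j : 'I_n.+1) : simplex n :=
  Sub (\row_k (k == j)%:R) (vertex_subproof j).

Lemma face_vertex n (i : 'I_n.+2) (j : 'I_n.+1) :
  face_fun i (vertex j) = vertex (lift i j).
Proof.
apply: val_inj; apply/rowP => k; rewrite !mxE.
case: unliftP => [k' ->|->] /=; first by rewrite mxE (inj_eq lift_inj).
by rewrite (negbTE (neq_lift i j)).
Qed.

Lemma simplex0_eq (t : simplex 0) : t = vertex ord0.
Proof.
apply: val_inj; apply/rowP => k; rewrite !mxE (ord1 k) eqxx.
by have [_] := set_mem (valP t); rewrite big_ord1.
Qed.

Lemma simplex_lift n (s : singular_simplex R n (circle R)) : (0 < n < 3)%N ->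
  exists2 u : simplex n -> R, continuous u & forall t, expi (u t) = s t.
Proof.
move=> n12.
have [i [r [ci cr ir]]] : exists (i : simplex n -> R * R) (r : R * R -> simplex n),
    [/\ continuous i, continuous r & cancel i r].
  by case: n s n12 => [//|[|[|//]]] _ _; [exact: simplex1_retract|exact: simplex2_retract].
have [a ea] := expi_surj (s (vertex ord0)).
have [u [cu su _]] := retract_lift expi_covering ci cr ir (@cts_fun _ _ s) ea.
by exists u.
Qed.

(** The change of angle along [s], in turns. The lift is an arbitrary choice, and [wind_simplexE]
    removes the dependence on it. *)
Definition wind_simplex (s : singular_simplex R 1 (circle R)) : R :=
  let u := s2val (cid2 (simplex_lift s isT)) in u (vertex ord_max) - u (vertex ord0).

(** Two lifts differ by an integer at the first vertex, hence by the same constant on the whole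
    simplex, and the constant cancels. *)
Lemma wind_simplexE (s : singular_simplex R 1 (circle R)) (u : simplex 1 -> R) :
  continuous u -> (forall t, expi (u t) = s t) ->
  wind_simplex s = u (vertex ord_max) - u (vertex ord0).
Proof.
move=> cu su; rewrite /wind_simplex; case: cid2 => v cv sv /=.
pose w t := u t + (v (vertex ord0) - u (vertex ord0)).
have wi : v (vertex ord0) - u (vertex ord0) \is a Num.int.
  by apply: expi_inj; rewrite su sv.
have cw : continuous w by move=> t; exact: (cvgD (cu t) (cvg_cst _)).
have [i [r [ci cr ir]]] := simplex1_retract R.
have vw t : v t = w t.
  apply: (@lift_unique _ _ _ _ expi_covering setT v w (vertex ord0)) => //.
  - exact: retract_connected cr ir.
  - exact: continuous_subspaceT.
  - exact: continuous_subspaceT.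
  - by move=> x _; rewrite sv /w expi_int.
  - by rewrite /w addrC subrK.
rewrite !vw /w; ring.
Qed.

Definition wind : chain R 1 (circle R) -> zmodule R := simplexwise wind_simplex.
HB.instance Definition _ := GRing.Additive.on wind.

Lemma windZ (k : int) c : wind (k *: c) = k *: wind c.
Proof. exact: (int_additiveZ wind). Qed.

Lemma windU s : wind << s >> = wind_simplex s.
Proof. exact: simplexwiseU. Qed.

Lemma boundaryU n (X : topologicalType) (s : singular_simplex R n.+1 X) :
  boundary << s >> = \sum_(i < n.+2) (-1) ^+ i *: << simplex_face i s >> :> chain R n X.
Proof. by rewrite /boundary liftU scale1r. Qed.

Lemma pushU n (X Y : topologicalType) (f : continuousType X Y) (s : singular_simplex R n X) :
  push f << s >> = << push_simplex f s >>.
Proof. by rewrite /push liftU scale1r. Qed.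

(** A singular 2-simplex lifts as a whole to the line, so the increments along its edges come from
    one function on the vertices and cancel. *)
Lemma wind_boundary (b : chain R 2 (circle R)) : wind (boundary b) = 0.
Proof.
suff : wind \o @boundary R 1 _ =1 \0 by apply.
apply: chain_additive_eq => s /=; rewrite boundaryU raddf_sum /=.
have [u cu su] := simplex_lift s isT.
have wf i : wind << simplex_face i s >> =
    u (vertex (lift i ord_max)) - u (vertex (lift i ord0)).
  rewrite windU (@wind_simplexE _ (u \o face_fun i)).
  - by rewrite /= !face_vertex.
  - by move=> t; apply: continuous_comp; [exact: face_fun_continuous|exact: cu].
  - by move=> t; rewrite /= su.
under eq_bigr do rewrite windZ wf.
rewrite !big_ord_recl big_ord0 /= addr0 expr0 scale1r expr1 scaleN1r.
rewrite -signr_odd /= expr0 scale1r.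
have -> : lift ord0 ord_max = ord_max :> 'I_3 by apply: val_inj.
have -> : lift (lift ord0 ord0) ord_max = ord_max :> 'I_3 by apply: val_inj.
have -> : lift (lift ord0 ord0) ord0 = ord0 :> 'I_3 by apply: val_inj.
have -> : lift (lift ord0 (lift ord0 ord0)) ord0 = ord0 :> 'I_3 by apply: val_inj.
have -> : lift (lift ord0 (lift ord0 ord0)) ord_max = lift ord0 ord0 :> 'I_3 by apply: val_inj.
move: (u _) (u _) (u _) => x y z.
change (z - y + (- (z - x) + (y - x)) = 0 :> R); ring.
Qed.

(** The 0-cochain given by [L]; composed with [boundary] it is a coboundary and vanishes on cycles.
    [L] may be discontinuous, like the pointwise logarithm in [wind_int]. *)
Definition vertex_eval (X : topologicalType) (L : X -> R) : chain R 0 X -> zmodule R :=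
  simplexwise (fun p => L (p (vertex ord0))).
HB.instance Definition _ X L := GRing.Additive.on (@vertex_eval X L).

Lemma vertex_evalZ (X : topologicalType) (L : X -> R) (k : int) c :
  vertex_eval L (k *: c) = k *: vertex_eval L c.
Proof. exact: (int_additiveZ (vertex_eval L)). Qed.

Lemma vertex_eval_boundaryU (X : topologicalType) (L : X -> R) (s : singular_simplex R 1 X) :
  vertex_eval L (boundary << s >>) = L (s (vertex ord_max)) - L (s (vertex ord0)).
Proof.
have af i : vertex_eval L << simplex_face i s >> = L (s (vertex (lift i ord0))).
  by rewrite /vertex_eval simplexwiseU /= /simplex_face /= face_vertex.
rewrite boundaryU raddf_sum /=.
under eq_bigr do rewrite vertex_evalZ af.
rewrite !big_ord_recl big_ord0 addr0 /= expr0 scale1r expr1 scaleN1r.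
by congr (L (s _) - L (s _)); apply: val_inj; apply/rowP => k; rewrite !mxE; congr (_ == _)%:R;
  apply: val_inj.
Qed.

(** The winding of each simplex is the difference of [L] at its ends, so winding along [g] is a
    coboundary. *)
Lemma wind_push_lift (X : topologicalType) (g : continuousType X (circle R)) (L : X -> R)
    (c : chain R 1 X) :
  continuous L -> (forall x, expi (L x) = g x) -> boundary c = 0 -> wind (push g c) = 0.
Proof.
move=> cL gL c0.
suff -> : wind (push g c) = vertex_eval L (boundary c) by rewrite c0 raddf0.
suff : wind \o @push R 1 _ _ g =1 vertex_eval L \o @boundary R 0 _ by apply.
apply: chain_additive_eq => s /=; rewrite pushU windU vertex_eval_boundaryU.
rewrite (@wind_simplexE _ (L \o s)) //.
- by move=> t; apply: continuous_comp; [exact: cts_fun|exact: cL].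
- by move=> t; rewrite /= gL.
Qed.

(** Subtracting the coboundary of an arbitrary pointwise logarithm [L] keeps the value on cycles and
    makes the contribution of each simplex an integer. *)
Lemma wind_int (c : chain R 1 (circle R)) : boundary c = 0 ->
  (wind c : R) \is a Num.int.
Proof.
move=> c0; have [L LK] := choice (@expi_surj R).
pose phi (s : singular_simplex R 1 (circle R)) :=
  wind_simplex s - (L (s (vertex ord_max)) - L (s (vertex ord0))).
suff -> : wind c = simplexwise phi c.
  apply: simplexwise_int => s; have [u cu su] := simplex_lift s isT.
  rewrite /phi (wind_simplexE cu su) opprB.
  rewrite (_ : _ + _ = (u (vertex ord_max) - L (s (vertex ord_max))) -
    (u (vertex ord0) - L (s (vertex ord0)))); last by ring.
  by apply: rpredB; apply: expi_inj; rewrite LK su.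
suff : wind =1 simplexwise phi \+ (vertex_eval L \o @boundary R 0 _).
  by move=> /(_ c) ->; rewrite /= c0 raddf0 addr0.
apply: chain_additive_eq => s /=.
rewrite windU vertex_eval_boundaryU simplexwiseU.
by rewrite [RHS](subrK (L (s (vertex ord_max)) - L (s (vertex ord0)))).
Qed.

Lemma loop_subproof : continuous (fun t : simplex 1 => expi (\val t ord0 ord_max)).
Proof.
move=> t; apply: (@continuous_comp _ _ _ (fun t : simplex 1 => \val t ord0 ord_max) expi).
  exact: simplex_coord_continuous.
exact: expi_continuous.
Qed.

Definition loop : singular_simplex R 1 (circle R) := mkcts loop_subproof.

Lemma loop_cycle : (<< loop >> : chain R 1 (circle R)) \in @is_cycle R (circle R).
Proof.
rewrite unfold_in; apply/eqP; rewrite boundaryU !big_ord_recl big_ord0 addr0 /=.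
rewrite expr0 scale1r expr1 scaleN1r; apply/eqP; rewrite subr_eq0; apply/eqP.
congr << _ >>; apply/continuousEP => t; rewrite (simplex0_eq t) /= !face_vertex.
change (expi (\val (vertex (lift ord0 (@ord0 0))) ord0 ord_max) =
        expi (\val (vertex (lift (lift ord0 ord0) (@ord0 0))) ord0 ord_max)).
rewrite !mxE; by apply/expi_eq; apply: rpredB; exact: natr_int.
Qed.

Lemma wind_loop : wind << loop >> = 1.
Proof.
rewrite windU (@wind_simplexE _ (fun t => \val t ord0 ord_max)) //.
  by rewrite !mxE eqxx subr0.
exact: simplex_coord_continuous.
Qed.

(** The class [u0] is that of [loop], and homologous cycles have equal winding numbers. Both
    [degree_unit] and [not_essential] use homology in this form. *)
Lemma H1_circle_generator : exists u0 : H1 R (circle R),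
  forall (X : topologicalType) (g : continuousType X (circle R)) (u : H1 R X),
  H1_map R g u = u0 -> exists2 c : chain R 1 X, boundary c = 0 & wind (push g c) = 1.
Proof.
exists (\pi_(H1 R (circle R)) (Cycle loop_cycle)) => X g u /eqP.
rewrite /H1_map -Quotient.idealrBE unfold_in => /asboolP[b /= bE].
exists (cycle_chain (repr u)); first exact/eqP/(valP (repr u)).
have := wind_boundary b; rewrite bE raddfB /= wind_loop => /eqP.
by rewrite subr_eq0 => /eqP.
Qed.

End Winding.

(** * Invariant frontiers in the plane *)

Section PlaneDynamics.
Variable R : realType.
Local Notation plane := (R * R)%type.

Lemma closure_image (X Y : topologicalType) (F : X -> Y) (A : set X) (B : set Y) x :
  continuous F -> (forall y, A y -> B (F y)) -> closure A x -> closure B (F x).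
Proof.
move=> cF AB Ax W /cF /Ax [y [Ay Wy]]; exists (F y); split=> //; exact: AB.
Qed.

(** The image of a component is connected and stays in [O], so a single point that does not leave
    the component is enough. *)
Lemma component_stable (X : topologicalType) (F : X -> X) (O : set X) (x y : X) :
  continuous F -> (forall z, O z -> O (F z)) ->
  connected_component O x y -> connected_component O x (F y) ->
  forall z, connected_component O x z -> connected_component O x (F z).
Proof.
move=> cF OF xy xFy z xz; rewrite (same_connected_component xFy).
apply: (@connected_component_max _ O (F @` connected_component O x)) => //.
- by move=> _ [w xw <-]; apply: OF; exact: connected_component_sub xw.
- apply: connected_continuous_connected; first exact: component_connected.
  exact: continuous_subspaceT.
Qed.

Definition vshift (p : plane) (a : R) : plane := (p.1, p.2 + a).

Lemma vshift_continuous a : continuous (vshift^~ a).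
Proof.
apply: pair_continuous; first by move=> p; exact: cvg_fst.
have c2 : continuous (fun p : plane => p.2) by move=> p; exact: cvg_snd.
by move=> p; exact: (cvgD (c2 p) (cvg_cst a)).
Qed.

Section Ends.
Variables (H : plane -> R) (k : R).
Hypotheses (cH : continuous H) (Hk : forall p (n : nat), H (vshift p (n%:R * k)) = H p + n%:R).
Let Pos := [set p | 0 < H p].

(* [H] is bounded below on the segment from [p] to [q], so a large translate of
   this segment lies in [Pos]. *)
Lemma component_vshift p q : exists N : nat, forall n, (N <= n)%N ->
  connected_component Pos (vshift p (n%:R * k)) (vshift q (n%:R * k)).
Proof.
have cs : continuous (H \o seg p q).
  by move=> t; apply: continuous_comp; [exact: seg_continuous|exact: cH].
have [c _ cmin] := @EVT_min R _ 0 1 ler01 (continuous_subspaceT cs).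
exists (Num.truncn (- H (seg p q c))).+1 => n Nn.
pose S := vshift^~ (n%:R * k) @` (seg p q @` `[0, 1]).
apply: (@connected_component_max _ Pos S).
- by exists p => //; exists 0; [rewrite /= in_itv /= ler01 lexx|exact: seg0].
- move=> _ [_ [t /= t01 <-] <-]; rewrite /Pos /= Hk.
  have h1 := cmin t t01; rewrite /= in h1.
  have h2 := truncnS_gt (- H (seg p q c)).
  have h3 : (Num.truncn (- H (seg p q c))).+1%:R <= n%:R :> R by rewrite ler_nat.
  lra.
- apply: connected_continuous_connected; last first.
    by apply: continuous_subspaceT; exact: vshift_continuous.
  by apply: segment_image_connected; exact: seg_continuous.
- by exists q => //; exists 1; [rewrite /= in_itv /= ler01 lexx|exact: seg1].
Qed.

(** From [N0] on, consecutive translates of the origin are joined inside [Pos], so one component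
    contains them all; other points are compared with the origin. Applied to [- H] and [- k], this
    gives the opposite end. *)
Lemma component_end : exists p0, forall p, exists N : nat, forall n, (N <= n)%N ->
  connected_component Pos p0 (vshift p (n%:R * k)).
Proof.
pose b : plane := (0, 0).
have [N0 bN] := component_vshift b (vshift b k).
pose p0 := vshift b (N0%:R * k).
have ladder n : (N0 <= n)%N -> connected_component Pos p0 (vshift b (n%:R * k)).
  move=> /subnK <-; elim: (n - N0)%N => [|m IH].
    have := bN N0 (leqnn _); rewrite -/p0 => h.
    exact: (connected_component_trans h (connected_component_sym h)).
  apply: (connected_component_trans IH).
  have := bN (m + N0)%N (leq_addl _ _).
  suff -> : vshift (vshift b k) ((m + N0)%:R * k) = vshift b ((m.+1 + N0)%:R * k) by [].
  by rewrite /vshift /= addSn -addn1 [in RHS]natrD mulrDl mul1r !add0r addrC.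
exists p0 => p; have [N pN] := component_vshift b p.
exists (maxn N N0) => n; rewrite geq_max => /andP[n1 n2].
exact: (connected_component_trans (ladder _ n2) (pN _ n1)).
Qed.

End Ends.

Section Frontier.
Variables (H : plane -> R) (k : R) (F G : plane -> plane) (d : nat).
Hypotheses (cH : continuous H) (cF : continuous F) (cG : continuous G).
Hypotheses (k2 : k * k = 1) (d0 : (0 < d)%N).
Hypothesis Hk : forall p (n : R), n \is a Num.int -> H (vshift p n) = H p + n * k.
Hypotheses (FK : cancel F G) (GK : cancel G F).
Hypothesis HF : forall p, H (F p) = d%:R * H p.
Hypothesis Fk : forall p (n : R), n \is a Num.int -> F (vshift p n) = vshift (F p) (d%:R * n).
Hypothesis ki : k \is a Num.int.

Theorem invariant_frontier : exists D : set plane,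
  [/\ closed D, connected D, forall p, D p -> H p = 0, F @` D = D &
      forall s, exists t, D (s, t)].
Proof.
have d0' : 0 < d%:R :> R by rewrite ltr0n.
have HG p : d%:R * H (G p) = H p by rewrite -HF GK.
have nki (n : nat) : n%:R * k \is a Num.int by apply: rpredM => //; exact: natr_int.
have nkiN (n : nat) : n%:R * - k \is a Num.int by rewrite mulrN rpredN.
have Hp p (n : nat) : H (vshift p (n%:R * k)) = H p + n%:R by rewrite Hk // -mulrA k2 mulr1.
have Hn p (n : nat) : - H (vshift p (n%:R * - k)) = - H p + n%:R.
  by rewrite mulrN Hk ?rpredN // mulNr -mulrA k2 mulr1 opprB addrC.
have cHN : continuous (fun p => - H p) by move=> p; apply: cvgN; exact: cH.
have [p0 p0P] := component_end cH Hp.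
have [q0 q0P] := component_end cHN Hn.
move: p0P q0P; set Pos := [set p | 0 < H p]; set Neg := [set p | 0 < - H p].
set V := connected_component Pos p0 => p0P q0P.
have oPos : open Pos by have /continuousP/(_ [set x | 0 < x] (@open_gt _ 0)) := cH; apply: id.
have oV : open V by exact: component_open.
(* The point required by [component_stable] is a far translate of [p0]: its image is a translate of
   [F p0] by [d * n] steps, and [d * n >= n] stays beyond the threshold. *)
have Vp0 : exists n : nat, V (vshift p0 (n%:R * k)) /\ V (F (vshift p0 (n%:R * k))).
  have [N1 h1] := p0P p0; have [N2 h2] := p0P (F p0).
  exists (maxn N1 N2); split; first by apply: h1; exact: leq_maxl.
  rewrite Fk // mulrA -natrM; apply: h2.
  by rewrite (leq_trans (leq_maxr N1 N2)) // leq_pmull.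
have [n1 [Vy VFy]] := Vp0.
have FV z : V z -> V (F z).
  apply: (@component_stable _ F Pos p0 (vshift p0 (n1%:R * k))) => // w.
  by rewrite /Pos /= HF; exact: mulr_gt0.
have GV z : V z -> V (G z).
  apply: (@component_stable _ G Pos p0 (F (vshift p0 (n1%:R * k)))) => //.
    by move=> w; rewrite /Pos /= -(HG w) pmulr_rgt0.
  by rewrite FK.
pose M := closure V.
have FM z : M z -> M (F z) by exact: closure_image.
have GM z : M z -> M (G z) by exact: closure_image.
have M_ge0 p : M p -> 0 <= H p.
  have cl : closed [set p | 0 <= H p].
    by have /continuous_closedP/(_ [set x | 0 <= x] (@closed_ge _ 0)) := cH; apply: id.
  move=> Mp; apply: cl; apply: closureS Mp => z /connected_component_sub; exact: ltW.
have clM : closed M by exact: closed_closure.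
have cM : connected M by apply: connected_closure; exact: component_connected.
have M0 : M !=set0 by exists (vshift p0 (n1%:R * k)); exact: subset_closure.
pose Z := connected_component (~` M) q0.
have NegZ p : connected_component Neg q0 p -> Z p.
  move=> q0p; have q0Neg : Neg q0.
    by apply: contrapT => /connected_component_out e; rewrite e in q0p.
  apply: (@connected_component_max _ (~` M) (connected_component Neg q0)) => //.
  - exact: connected_component_refl.
  - move=> z /connected_component_sub; rewrite /Neg /= => z0 /M_ge0; lra.
  - exact: component_connected.
have {q0P}ZP p : exists N : nat, forall n, (N <= n)%N -> Z (vshift p (n%:R * - k)).
  by have [N h] := q0P p; exists N => n /h; exact: NegZ.
have oZ : open Z by apply: component_open; rewrite openC.
have [n2 [Zy ZFy]] : exists n : nat, Z (vshift q0 (n%:R * - k)) /\ Z (F (vshift q0 (n%:R * - k))).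
  have [N1 h1] := ZP q0; have [N2 h2] := ZP (F q0).
  exists (maxn N1 N2); split; first by apply: h1; exact: leq_maxl.
  rewrite Fk ?nkiN // mulrA -natrM; apply: h2.
  by rewrite (leq_trans (leq_maxr N1 N2)) // leq_pmull.
have FZ z : Z z -> Z (F z).
  apply: (@component_stable _ F (~` M) q0 (vshift q0 (n2%:R * - k))) => // w Mw.
  by move=> /GM; rewrite FK.
have GZ z : Z z -> Z (G z).
  apply: (@component_stable _ G (~` M) q0 (F (vshift q0 (n2%:R * - k)))) => //.
    by move=> w Mw /FM; rewrite GK.
  by rewrite FK.
exists (closure Z `\` Z); split.
- exact: component_bd_closed.
- exact: component_bd_connected.
- move=> p Dp; have Mp : M p by exact: (@component_bd_sub _ _ clM q0).
  apply/eqP; rewrite eq_le M_ge0 // andbT leNgt; apply/negP => Hp0.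
  (* With [H p > 0], the component of [p] in [Pos] is a neighbourhood of [p] and meets [V]. So [p]
     lies in the open set [V], and [Z], which accumulates at [p], would meet [V]. *)
  have [z [Vz pz]] : V `&` connected_component Pos p !=set0.
    by apply: Mp; apply: open_nbhs_nbhs; split; [exact: component_open|exact: connected_component_refl].
  have Vp : V p by exact: (connected_component_trans Vz (connected_component_sym pz)).
  have [w [Zw Vw]] : Z `&` V !=set0 by apply: Dp.1; exact: open_nbhs_nbhs.
  by have := connected_component_sub Zw; apply; exact: subset_closure.
- apply/seteqP; split=> [_ [p [clp nZ] <-]|p [clp nZ]].
    split; first exact: (closure_image cF FZ clp).
    by move=> /GZ; rewrite FK.
  exists (G p); last exact: GK.
  split; first exact: (closure_image cG GZ clp).
  by move=> /FZ; rewrite GK.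
(* On a vertical line that misses the frontier, [Z] is clopen and nonempty, hence the whole line;
   but the line reaches [V] in the direction of [k]. *)
move=> s; apply: contrapT => nD.
pose l : set plane := [set p | p.1 = s].
have cl : connected l.
  by apply: convex_connected => x y t; rewrite /l /= => -> -> _; ring.
have lZ : l `&` Z = l.
  have [N h] := ZP (s, 0); apply: cl.
  - by exists (vshift (s, 0) (N%:R * - k)); split=> //; exact: h.
  - by exists Z.
  - exists (closure Z); first exact: closed_closure.
    apply/seteqP; split=> -[a b] [la Zb]; split=> //; first exact: subset_closure.
    apply: contrapT => nZ; apply: nD; exists b; move: la Zb nZ; rewrite /l /= => ->.
    by split.
have [N h] := p0P (s, 0); have Vl := h N (leqnn _).
have : Z (vshift (s, 0) (N%:R * k)).
  by have [] : (l `&` Z) (vshift (s, 0) (N%:R * k)) by rewrite lZ.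
by move=> /connected_component_sub; apply; exact: subset_closure.
Qed.

End Frontier.
End PlaneDynamics.

(** * The universal cover of the annulus *)

Section AnnulusCover.
Variable R : realType.
Local Notation plane := (R * R)%type.
Local Notation annulus := (annulus R).

Lemma unit_coord_subproof (s : R) : atan s / pi + 1 / 2 \in (`]0, 1[%classic : set R).
Proof.
have p0 := pi_gt0 R; have h1 := atan_gtNpi2 s; have h2 := atan_ltpi2 s.
apply/mem_set; rewrite /= in_itv /=; apply/andP; split.
  suff : - (1 / 2) < atan s / pi by lra.
  by rewrite ltr_pdivlMr //; lra.
suff : atan s / pi < 1 / 2 by lra.
by rewrite ltr_pdivrMr //; lra.
Qed.

Definition unit_coord (s : R) : set_type (`]0, 1[%classic : set R) :=
  Sub (atan s / pi + 1 / 2) (unit_coord_subproof s).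

Definition line_coord (x : set_type (`]0, 1[%classic : set R)) : R := tan (pi * (\val x - 1 / 2)).

Lemma line_coord_itv (x : set_type (`]0, 1[%classic : set R)) :
  - (pi / 2) < pi * (\val x - 1 / 2) < pi / 2.
Proof.
have p0 := pi_gt0 R; have := set_mem (valP x); rewrite /= in_itv /= => /andP[h1 h2].
by apply/andP; split; nra.
Qed.

Lemma unit_coordK : cancel unit_coord line_coord.
Proof.
move=> s; have p0 := pi_gt0 R; rewrite /line_coord /= addrK mulrC divfK ?gt_eqF //.
exact: atanK.
Qed.

Lemma line_coordK : cancel line_coord unit_coord.
Proof.
move=> x; have p0 := pi_gt0 R; apply: val_inj; rewrite /= /line_coord tanK ?in_itv ?line_coord_itv //.
by rewrite mulrC mulKf ?gt_eqF // subrK.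
Qed.

Lemma unit_coord_continuous : continuous unit_coord.
Proof.
move=> s; apply/continuous_comp_initial => {}s.
exact: (cvgD (cvgM (@continuous_atan R s) (cvg_cst _)) (cvg_cst _)).
Qed.

Lemma line_coord_continuous : continuous line_coord.
Proof.
move=> x.
have c1 : {for x, continuous (fun x : set_type (`]0, 1[%classic : set R) => pi * (\val x - 1 / 2))}.
  exact: (cvgM (cvg_cst _) (cvgB (@set_val_continuous _ _ x) (cvg_cst _))).
apply: (continuous_comp c1); apply: continuous_tan.
by rewrite gt_eqF // cos_gt0_pihalf // line_coord_itv.
Qed.

(** The universal covering of the annulus, with the integer vertical shifts as deck translations. *)
Definition roll (p : plane) : annulus := (unit_coord p.1, expi p.2).

Lemma roll_continuous : continuous roll.
Proof.
apply: pair_continuous => p.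
  by apply: continuous_comp; [exact: cvg_fst|exact: unit_coord_continuous].
by apply: continuous_comp; [exact: cvg_snd|exact: expi_continuous].
Qed.

Lemma roll_eq p q : roll p = roll q <-> p.1 = q.1 /\ p.2 - q.2 \is a Num.int.
Proof.
split=> [e|[e1 e2]].
  by split; [apply: (can_inj unit_coordK); exact: (congr1 fst e)|apply: expi_inj; exact: (congr1 snd e)].
by rewrite /roll e1; congr pair; apply/expi_eq.
Qed.

Lemma roll_vshift p n : n \is a Num.int -> roll (vshift p n) = roll p.
Proof. by move=> ni; rewrite /roll /vshift /= expi_int. Qed.

Lemma roll_surj a : exists p, roll p = a.
Proof.
case: a => x z; have [t <-] := expi_surj z; exists (line_coord x, t).
by rewrite /roll /= line_coordK.
Qed.

Lemma fst_annulus_continuous : continuous (fun a : annulus => a.1).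
Proof. by move=> a; exact: cvg_fst. Qed.

Lemma snd_annulus_continuous : continuous (fun a : annulus => a.2).
Proof. by move=> a; exact: cvg_snd. Qed.

(** Only the angular coordinate has to be lifted, through [expi]; the radial one is transported by
    the homeomorphism [line_coord]. *)
Lemma roll_lift (g : plane -> annulus) x0 p0 : continuous g -> roll p0 = g x0 ->
  exists G, [/\ continuous G, forall x, roll (G x) = g x & G x0 = p0].
Proof.
move=> cg pg.
have cg2 : continuous (fun x => (g x).2).
  by move=> x; apply: continuous_comp; [exact: cg|exact: snd_annulus_continuous].
have cg1 : continuous (fun x => line_coord (g x).1).
  move=> x; apply: (@continuous_comp _ _ _ (fun x => (g x).1)).
    by apply: continuous_comp; [exact: cg|exact: fst_annulus_continuous].
  exact: line_coord_continuous.
have [|u [cu eu u0]] := plane_lift expi_covering cg2 (x0 := x0) (e0 := p0.2).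
  by rewrite -pg.
exists (fun x => (line_coord (g x).1, u x)); split.
- exact: pair_continuous.
- by move=> x; rewrite /roll /= line_coordK eu -surjective_pairing.
- by rewrite -pg u0 /= unit_coordK -surjective_pairing.
Qed.

Lemma roll_lift_unique (X : topologicalType) (G1 G2 : X -> plane) x0 :
  connected [set: X] -> continuous G1 -> continuous G2 ->
  (forall x, roll (G1 x) = roll (G2 x)) -> G1 x0 = G2 x0 -> G1 =1 G2.
Proof.
move=> cX c1 c2 G12 e0 x.
have [e1 _] := (roll_eq _ _).1 (G12 x).
have snd_c (G : X -> plane) : continuous G -> {within setT, continuous (fun x => (G x).2)}.
  move=> cG; apply: continuous_subspaceT => y.
  by apply: continuous_comp; [exact: cG|exact: cvg_snd].
have e2 : (G1 x).2 = (G2 x).2.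
  apply: (@lift_unique _ _ _ _ expi_covering setT (fun x => (G1 x).2) (fun x => (G2 x).2) x0) => //.
  - exact: snd_c.
  - exact: snd_c.
  - by move=> y _; exact: (congr1 snd (G12 y)).
  - by rewrite e0.
by rewrite [LHS]surjective_pairing e1 e2 -surjective_pairing.
Qed.

(** A continuous local section [eta] with [eta (roll p) = p] pulls [O] back to a neighbourhood of
    [roll p]. Openness of [roll] lets closedness be checked in the plane. *)
Lemma roll_nbhs p (O : set plane) : nbhs p O -> nbhs (roll p) (roll @` O).
Proof.
move=> Op; have [l lP lK] := expi_section p.2.
pose eta (a : annulus) : plane := (line_coord a.1, l a.2).
have c0 : 0 < cre (crot p.2 (expi p.2)) by rewrite crot_expi subrr cre_expi mulr0 cos0.
have etap : eta (roll p) = p.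
  rewrite /eta /= unit_coordK (lK p.2 0) ?rpred0 ?subr0 ?subrr ?normr0 -?surjective_pairing //; lra.
have ceta : {for roll p, continuous eta}.
  have [_ cl _] := lP _ c0.
  exact: (cvg_pair (continuous_comp (@fst_annulus_continuous (roll p)) (@line_coord_continuous _))
    (continuous_comp (@snd_annulus_continuous (roll p)) cl)).
have n1 : \forall a \near roll p, O (eta a) by apply: ceta; rewrite etap.
have cr : continuous (fun a : annulus => cre (crot p.2 a.2)).
  move=> a; apply: (@continuous_comp _ _ _ (fun a : annulus => crot p.2 a.2)).
    by apply: continuous_comp; [exact: snd_annulus_continuous|exact: crot_continuous].
  exact: cre_continuous.
have n2 : \forall a \near roll p, 0 < cre (crot p.2 a.2).
  have /continuousP/(_ [set x | 0 < x] (@open_gt _ 0)) oc := cr.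
  by apply: (@open_nbhs_nbhs _ (roll p)); split.
near=> a; exists (eta a); first by near: a.
have [e _ _] : [/\ expi (l a.2) = a.2, {for a.2, continuous l} & `|l a.2 - p.2| < 1 / 4].
  by apply: lP; near: a.
by rewrite /roll /eta /= line_coordK e -surjective_pairing.
Unshelve. all: by end_near. Qed.

End AnnulusCover.

Arguments roll {R} p.
Arguments roll_continuous {R} x.

(** * Behaviour of lifts under deck translations *)

Section Degree.
Variable R : realType.
Local Notation plane := (R * R)%type.
Local Notation annulus := (annulus R).

Lemma vshiftD (p : plane) a b : vshift (vshift p a) b = vshift p (a + b).
Proof. by rewrite /vshift /= addrA. Qed.

Lemma vshift0 (p : plane) : vshift p 0 = p.
Proof. by rewrite /vshift addr0 -surjective_pairing. Qed.

(** [H (vshift p 1)] and [H p + k] lift the same map and agree at the origin. This serves for the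
    lift of [h] and for the angular coordinate of [F]. *)
Lemma lift_vshift (g : annulus -> circle R) (H : plane -> R) :
  continuous H -> (forall p, expi (H p) = g (roll p)) ->
  exists2 k, k \is a Num.int &
    forall p n, n \is a Num.int -> H (vshift p n) = H p + n * k.
Proof.
move=> cH gH; pose o : plane := (0, 0); pose k := H (vshift o 1) - H o.
have ki : k \is a Num.int by apply: expi_inj; rewrite !gH roll_vshift.
exists k => //.
have H1 p : H (vshift p 1) = H p + k.
  apply: (@lift_unique _ _ _ _ expi_covering setT (fun p => H (vshift p 1)) (fun p => H p + k) o) => //.
  - exact: plane_connected.
  - apply: continuous_subspaceT => q.
    exact: (continuous_comp (@vshift_continuous R 1 q) (cH _)).
  - apply: continuous_subspaceT => q; exact: (cvgD (cH q) (cvg_cst k)).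
  - by move=> q _; rewrite expi_int // !gH roll_vshift.
  - by rewrite /k addrC subrK.
have Hn p (n : nat) : H (vshift p n%:R) = H p + n%:R * k.
  elim: n => [|n IH]; first by rewrite vshift0 mul0r addr0.
  by rewrite -natr1 -vshiftD H1 IH; ring.
move=> p _ /intrP[[n|n] ->]; first exact: Hn.
by rewrite NegzE -[in RHS](vshift0 p) -(addNr n.+1%:R) -vshiftD mulrNz Hn; ring.
Qed.

Definition snd_annulus : continuousType annulus (circle R) :=
  mkcts (@snd_annulus_continuous R).

(* [H p - p.2 * k] descends to a function [Q] on the annulus, so [h] winds around
   a cycle [k] times as much as the angular coordinate does. *)
Lemma degree_unit (h : continuousType annulus (circle R)) (H : plane -> R) (k : R) :
  continuous H -> (forall p, expi (H p) = h (roll p)) -> k \is a Num.int ->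
  (forall p n, n \is a Num.int -> H (vshift p n) = H p + n * k) ->
  (forall v, exists u, H1_map R h u = v) -> k * k = 1.
Proof.
move=> cH hH ki Hk hsurj.
have [u0 u0P] := H1_circle_generator R.
have [u hu] := hsurj u0; have [c c0 c1] := u0P _ _ _ hu.
have [m km] : exists m : int, k = m%:~R by exact/intrP.
have [L LK] := choice (@expi_surj R).
pose Q (a : annulus) := H (line_coord a.1, L a.2) - L a.2 * k.
have QE p : H p = p.2 * k + Q (roll p).
  rewrite /Q /= unit_coordK; have /expi_inj ni : expi p.2 = expi (L (expi p.2)) by rewrite LK.
  have := Hk (p.1, L (expi p.2)) _ ni.
  by rewrite /vshift /= addrC subrK -surjective_pairing => ->; ring.
have wE : @wind R \o @push R 1 _ _ h =1
    ( *:%R m \o (@wind R \o @push R 1 _ _ snd_annulus)) \+ (vertex_eval Q \o @boundary R 0 _).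
  apply: chain_additive_eq => s /=.
  rewrite !pushU !windU vertex_eval_boundaryU scalezrE.
  have [v cv sv] := simplex_lift (push_simplex snd_annulus s) isT.
  rewrite (wind_simplexE cv sv).
  pose w t : plane := (line_coord (s t).1, v t).
  have sw t : roll (w t) = s t.
    by rewrite /roll /w /= line_coordK sv /= -surjective_pairing.
  have cw : continuous w.
    apply: pair_continuous => // t.
    apply: (@continuous_comp _ _ _ (fun t => (s t).1)); last exact: line_coord_continuous.
    by apply: continuous_comp; [exact: cts_fun|exact: fst_annulus_continuous].
  rewrite (@wind_simplexE _ _ (H \o w)).
  - rewrite /= !QE !sw /= km; move: (v _) (v _) (Q _) (Q _) => a b a' b'.
    change (b * m%:~R + b' - (a * m%:~R + a') = (b - a) *~ m + (b' - a') :> R).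
    by rewrite -mulrzr; ring.
  - by move=> t; apply: continuous_comp; [exact: cw|exact: cH].
  - by move=> t; rewrite /= hH sw.
(* On the cycle [c] the boundary term vanishes, which leaves 1 equal to [m] times an integer. *)
have := wE c; rewrite /= c0 c1 raddf0 addr0 scalezrE.
have /intrP[n ->] : (wind (push snd_annulus c) : R) \is a Num.int.
  by apply: wind_int; rewrite boundary_push c0 raddf0.
rewrite /= -mulrzr -[X in X = _ -> _]/(1%:~R) -intrM => /intr_inj e.
have /esym/eqP := congr1 absz e; rewrite abszM muln_eq1 km => /andP[_ /eqP].
by case: (m) => [m' /= ->|[|m'] //= _]; rewrite ?NegzE ?mulrNN mulr1.
Qed.

End Degree.

(** * The invariant connector *)

Section Final.
Variable R : realType.
Local Notation plane := (R * R)%type.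
Local Notation annulus := (annulus R).

Lemma circle1E : circle1 R = expi 0.
Proof.
by apply: circle_eq; rewrite ?cre_expi ?cim_expi mulr0 ?cos0 ?sin0.
Qed.

Lemma circle_powE (n : nat) (t : R) : circle_pow n%:Z (expi t) = expi (n%:R * t).
Proof.
apply: val_inj; rewrite /= -exprnP; elim: n => [|n IH].
  by rewrite mul0r mulr0 cos0 sin0.
have -> : n.+1%:R * t = n%:R * t + t by rewrite -[n.+1%:R]natr1 mulrDl mul1r.
rewrite exprS IH mulrDr cosD sinD.
apply/eqP; rewrite eq_complex /=; apply/andP; split; apply/eqP; ring.
Qed.

Lemma push_comp n (X Y Z : topologicalType) (f : continuousType X Y) (g : continuousType Y Z)
    (c : chain R n X) : push g (push f c) = push (g \o f : continuousType X Z) c.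
Proof.
suff : @push R n _ _ g \o @push R n _ _ f =1 @push R n _ _ (g \o f : continuousType X Z) by apply.
by apply: chain_additive_eq => s /=; rewrite !pushU; congr << _ >>; apply/continuousEP.
Qed.

Lemma H1_map_comp (X Y Z : topologicalType) (f : continuousType X Y) (g : continuousType Y Z)
    (u : H1 R X) : H1_map R g (H1_map R f u) = H1_map R (g \o f : continuousType X Z) u.
Proof.
rewrite [H1_map R f u]/H1_map H1_map_pi /H1_map; congr (\pi_(H1 R Z) _).
by apply: val_inj; rewrite /= push_comp.
Qed.

(** On [U] the map [h] has the real lift [log0 \o h], so it winds 0 times around every cycle of [U];
    were [U] essential, some cycle of [U] would have winding number 1. *)
Lemma not_essential (h : continuousType annulus (circle R)) (C : set annulus) :
  (forall v, exists u, H1_map R h u = v) ->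
  C `<=` h @^-1` [set circle1 R] -> ~ essential C.
Proof.
move=> hsurj Ch /(_ [set a | 0 < cre (h a)]) ess.
set U := [set a | _] in ess.
have chh : continuous (fun a => cre (h a)).
  by move=> a; apply: continuous_comp; [exact: cts_fun|exact: cre_continuous].
have oU : open U.
  by have /continuousP/(_ [set x | 0 < x] (@open_gt _ 0)) := chh; apply: id.
have {}ess := ess oU _.
have [u0 u0P] := H1_circle_generator R.
have [u hu] := hsurj u0.
have [|v _ vu] := ess _ u Logic.I.
  by move=> a /Ch /= ha; rewrite /U /= ha circle1E cre_expi mulr0 cos0.
have := hu; rewrite -vu H1_map_comp => /u0P[c c0].
rewrite (@wind_push_lift _ _ _ (fun x : U => log0 (h (\val x)))) //.
- by move=> /eqP; rewrite eq_sym oner_eq0.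
- move=> x; have xU : 0 < cre (h (\val x)) by exact: (set_mem (valP x)).
  apply: (@continuous_comp _ _ _ (fun x : U => h (\val x))); last exact: log0_continuous.
  by apply: continuous_comp; [exact: set_val_continuous|exact: cts_fun].
- by move=> x; rewrite log0K //; exact: (set_mem (valP x)).
Qed.

Section RollImage.
Variables (H : plane -> R) (k : R) (D : set plane).
Hypotheses (cH : continuous H) (k2 : k * k = 1) (ki : k \is a Num.int).
Hypothesis Hk : forall p n, n \is a Num.int -> H (vshift p n) = H p + n * k.
Hypotheses (clD : closed D) (D0 : forall p, D p -> H p = 0).

(* [psi] moves a point of a translate of [D] back to [D] itself. *)
Lemma roll_image_closed : closed (roll @` D).
Proof.
pose psi q := vshift q (- (k * H q)).
pose P := [set q | cre (expi (H q)) = 1] `&` (psi @^-1` D).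
have clP : closed P.
  apply: closedI.
    have c1 : continuous (fun q => cre (expi (H q))).
      move=> q; apply: (@continuous_comp _ _ _ (fun q => expi (H q))).
        by apply: continuous_comp; [exact: cH|exact: expi_continuous].
      exact: cre_continuous.
    by have /continuous_closedP/(_ [set x | x = 1] (@closed_eq _ 1)) := c1; apply: id.
  have cpsi : continuous psi.
    apply: pair_continuous => q; first exact: cvg_fst.
    have c2 : continuous (fun p : plane => p.2) by move=> p; exact: cvg_snd.
    have cN : continuous (fun q => - (k * H q)).
      have cM : continuous (fun q => k * H q) by move=> r; apply: cvgM; [exact: cvg_cst|exact: cH].
      by move=> r; apply: cvgN; exact: cM.
    exact: (cvgD (c2 q) (cN q)).
  by have /continuous_closedP/(_ D clD) := cpsi; apply: id.
have CP q : (roll @` D) (roll q) -> P q.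
  move=> [q' Dq' /roll_eq[e1 e2]].
  have e : q = vshift q' (q.2 - q'.2) by rewrite /vshift e1 addrC subrK -surjective_pairing.
  have ji : q.2 - q'.2 \is a Num.int by rewrite -opprB rpredN.
  have Hq : H q = (q.2 - q'.2) * k by rewrite {1}e Hk // D0 // add0r.
  split; first by rewrite /= Hq -[X in expi X]add0r expi_int ?rpredM // cre_expi mulr0 cos0.
  rewrite /psi /= Hq mulrCA k2 mulr1 {1}e vshiftD subrr vshift0 //.
have PC q : P q -> (roll @` D) (roll q).
  move=> [/= c1 Dq]; exists (psi q) => //; apply: roll_vshift; rewrite rpredN rpredM //.
  rewrite -[H q]subr0; apply: expi_inj; rewrite -circle1E; apply: circle_eq.
    by rewrite c1.
  have := circleE (expi (H q)); rewrite c1 expr1n => /eqP.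
  by rewrite -subr_eq0 addrAC subrr add0r sqrf_eq0 => /eqP.
move=> a Ca; have [p pa] := roll_surj a; rewrite -pa; apply: PC; apply: contrapT => nP.
have nb : nbhs p (~` P) by apply: open_nbhs_nbhs; split=> //; rewrite openC.
have := Ca _ _; rewrite -pa => /(_ _ (roll_nbhs nb)) [b [Cb [q nPq qb]]].
by apply: nPq; apply: CP; rewrite qb.
Qed.

End RollImage.

Lemma unit_coord_surj (x : R) : 0 < x < 1 -> exists s, \val (unit_coord s) = x.
Proof.
move=> x01; have xP : x \in (`]0, 1[%classic : set R) by apply/mem_set; rewrite /= in_itv.
by exists (line_coord (Sub x xP)); rewrite line_coordK.
Qed.

End Final.

Theorem corollary9 (R : realType) (d : int) (hd : 1 < d)
    (f : continuousType (annulus R) (annulus R))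
    (hf : covering_map f) (hdeg : has_degree f d)
    (h : continuousType (annulus R) (circle R))
    (hh : semiconjugacy f d h) :
  exists C : set (annulus R),
    [/\ trivial_connector C, f @` C = C & C `<=` h @^-1` [set circle1 R]].
Proof.
case: d hd hh {hdeg} => // n n1 [hfE [h' _ hK]].
have hsurj v : exists u, H1_map R h u = v by exists (h' v).
pose o : R * R := (0, 0).
have chr : continuous (h \o roll).
  by move=> p; apply: continuous_comp; [exact: roll_continuous|exact: cts_fun].
have [t0 t0E] := expi_surj ((h \o roll) o).
have [H [cH hH _]] := plane_lift expi_covering chr t0E.
have {}hH p : expi (H p) = h (roll p) by exact: hH.
have [k ki Hk] := lift_vshift cH hH.
have k2 := degree_unit cH hH ki Hk hsurj.
have hfp a : h (f a) = circle_pow n (h a) by have := congr1 (fun g => g a) hfE.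
have [e e0] := roll_surj (f (roll o)).
have ci : H e - n%:R * H o \is a Num.int.
  by apply: expi_inj; rewrite hH e0 hfp -circle_powE hH.
(* An arbitrary lift [e] satisfies [H e = n%:R * H o] up to an integer; as [k * k = 1], this shift
   removes the error exactly. *)
pose e' := vshift e (- ((H e - n%:R * H o) * k)).
have e'E : roll e' = f (roll o) by rewrite /e' roll_vshift // rpredN rpredM.
have He' : H e' = n%:R * H o.
  by rewrite /e' Hk ?rpredN ?rpredM // mulNr -mulrA k2 mulr1 opprB addrC subrK.
have cfr : continuous (f \o roll).
  by move=> p; apply: continuous_comp; [exact: roll_continuous|exact: cts_fun].
have [F [cF FE Fo]] := roll_lift cfr e'E.
have {}FE p : roll (F p) = f (roll p) by exact: FE.
have HF p : H (F p) = n%:R * H p.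
  apply: (@lift_unique _ _ _ _ expi_covering setT (H \o F) (fun p => n%:R * H p) o) => //.
  - exact: plane_connected.
  - by apply: continuous_subspaceT => q; apply: continuous_comp; [exact: cF|exact: cH].
  - apply: continuous_subspaceT => q; exact: (cvgM (cvg_cst _) (cH q)).
  - by move=> q _; rewrite /= hH FE /= hfp -circle_powE hH.
  - by rewrite /= Fo He'.
have cF2 : continuous (fun p => (F p).2).
  by move=> p; apply: continuous_comp; [exact: cF|exact: cvg_snd].
have [|m mi Fm] := @lift_vshift R (fun a => (f a).2) _ cF2.
  by move=> p; rewrite -FE.
have Fv p a : a \is a Num.int -> F (vshift p a) = vshift (F p) (a * m).
  move=> ai; have rF : roll (F (vshift p a)) = roll (F p) by rewrite !FE roll_vshift.
  by have [e1 _] := (roll_eq _ _).1 rF; rewrite [LHS]surjective_pairing Fm // e1.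
(* The shift constant of [F] is read off from [HF] by comparing both sides after a unit shift. *)
have mn : m = n%:R.
  have := HF (vshift o 1); rewrite Fv ?int_num1 // mul1r !Hk ?int_num1 // HF mul1r mulrDr.
  by move=> /addrI /(congr1 ( *%R^~ k)); rewrite -!mulrA k2 !mulr1.
have Fk p a : a \is a Num.int -> F (vshift p a) = vshift (F p) (n%:R * a).
  by move=> ai; rewrite Fv // mn mulrC.
(* The inverse of [F]: [roll] is lifted through the covering [f] to [g], and [g] through [roll] to
   [G], based so that [G (F o) = o]. *)
have [g [cg gE go]] := plane_lift hf (roll_continuous) (esym (FE o) : f (roll o) = roll (F o)).
have [G [cG GE Go]] := roll_lift cg (esym go).
have GK : cancel G F.
  apply: (@roll_lift_unique _ _ (F \o G) id (F o)) => //.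
  - exact: plane_connected.
  - by move=> p; apply: continuous_comp; [exact: cG|exact: cF].
  - by move=> p; exact: cvg_id.
  - by move=> p; change (roll (F (G p)) = roll p); rewrite FE GE gE.
  - by change (F (G (F o)) = F o); rewrite Go.
have FK : cancel F G.
  have cGF : continuous (G \o F) by move=> p; apply: continuous_comp; [exact: cF|exact: cG].
  apply: (@roll_lift_unique _ _ (G \o F) id o) => //.
  - exact: plane_connected.
  - by move=> p; exact: cvg_id.
  (* The equality of the projections to the annulus is known only after applying [f], so uniqueness
     of lifts through [f] has to come before uniqueness through [roll]. *)
  - move=> p; apply: (@lift_unique _ _ _ _ hf setT (roll \o (G \o F)) (roll) o) => //.
    + exact: plane_connected.
    + apply: continuous_subspaceT => q.
      by apply: (@continuous_comp _ _ _ (G \o F)); [exact: cGF|exact: roll_continuous].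
    + by apply: continuous_subspaceT; exact: roll_continuous.
    + by move=> q _; change (f (roll (G (F q))) = f (roll q)); rewrite GE gE FE.
    + by change (roll (G (F o)) = roll o); rewrite Go.
have n0 : (0 < n)%N by case: n n1 {hfE hfp ci e' e'E He' HF mn Fk Fo}.
have [D [clD cD D0 FD Dv]] := invariant_frontier cH cF cG k2 n0 Hk FK GK HF Fk ki.
have Ch : roll @` D `<=` h @^-1` [set circle1 R].
  by move=> _ [p Dp <-]; rewrite /= -hH D0 // circle1E.
exists (roll @` D); split=> //; last first.
  apply/seteqP; split=> [_ [_ [p Dp <-] <-]|_ [p Dp <-]].
    by exists (F p); [rewrite -FD; exists p|rewrite FE].
  move: Dp; rewrite -[D in D p]FD => -[q Dq <-].
  by exists (roll q); [exists q|rewrite FE].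
split; last exact: not_essential Ch.
split.
- exact: (roll_image_closed cH k2 ki Hk clD D0).
- apply: connected_continuous_connected => //.
  by apply: continuous_subspaceT; exact: roll_continuous.
(* The radius sought is below [r]; the minimum with 1 keeps it inside the unit interval when [r] is
   large. *)
- move=> r r0; have [|s sE] := @unit_coord_surj R (Num.min r 1 / 2).
    have m0 : 0 < Num.min r 1 by rewrite lt_min r0 ltr01.
    have m1 : Num.min r 1 <= 1 by rewrite ge_min lexx orbT.
    by apply/andP; split; lra.
  have [t Dst] := Dv s; exists (roll (s, t)); first by exists (s, t).
  have m0 : 0 < Num.min r 1 by rewrite lt_min r0 ltr01.
  have m1 : Num.min r 1 <= r by rewrite ge_min lexx.
  rewrite /= -[_ / _ + _]/(\val (unit_coord s)) sE; lra.
- move=> r r0; have [|s sE] := @unit_coord_surj R (1 - Num.min r 1 / 2).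
    have m0 : 0 < Num.min r 1 by rewrite lt_min r0 ltr01.
    have m1 : Num.min r 1 <= 1 by rewrite ge_min lexx orbT.
    by apply/andP; split; lra.
  have [t Dst] := Dv s; exists (roll (s, t)); first by exists (s, t).
  have m0 : 0 < Num.min r 1 by rewrite lt_min r0 ltr01.
  have m1 : Num.min r 1 <= r by rewrite ge_min lexx.
  rewrite /= -[_ / _ + _]/(\val (unit_coord s)) sE; lra.
Qed.
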